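(* Assume (A1) $X$ is $C^\infty$; (A2) $\sigma_{\min}\big[\int_{\mathcal{R}}\frac{\rho}{\Delta t^2}\frac{\partial X}{\partial\theta}(x,\theta_-)^T\frac{\partial X}{\partial\theta}(x,\theta_-)\,dx\big]\ge\sigma_X>0$; (A3) for every $x\in\mathcal{C}$, $\partial^3 v_x/\partial\theta^3$ exists and is continuous. Then there exist $r>0$ and an $\alpha$-independent constant $M_V>0$ such that for every $\beta\in(0,1]$ there is $\alpha_3(\beta)>0$ with the following property: for every $\alpha\in(0,\alpha_3(\beta)]$, the first-order PGM generates a sequence $\{(\theta^k,w^k)\}$ such that (1) $V_\alpha(\theta^k,w^k)\le M_V$ for all $k$; (2) $\theta^k\in\mathcal{B}(\theta_-,r\beta/2)$ for all $k$; (3) each manifold projection converges at a rate of at least $3/4$, i.e. every projection update $\theta\mapsto\theta^+$ satisfies $V_\alpha(\theta^+,w)\le\frac34V_\alpha(\theta,w)$.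
   Context: Setting. $\theta\in\mathbb{R}^n$; robot region $\mathcal{R}\subset\mathbb{R}^3$ with density $\rho>0$; forward kinematics $X(x,\theta)\in\mathbb{R}^3$; finite contact set $\mathcal{C}\subset\mathcal{R}$; for $x\in\mathcal{C}$, $v_x:\mathbb{R}^n\to\mathbb{R}^{3\times V_x}$ and $w_x\in\mathbb{R}^{V_x}$; $w$ is the concatenation, feasible if $w_x\ge0$ and $\mathbf{1}^Tw_x\le1$ for every $x$. Fixed data $\Delta t>0$, $\theta_-,\theta_{--},\tau\in\mathbb{R}^n$, $\alpha\in(0,1]$. $A(\theta)=\int_{\mathcal{R}}\frac{\rho}{\Delta t^2}\frac{\partial X}{\partial\theta}(x,\theta)^T(X(x,\theta)-X(x,\theta_-))dx$, $B(\theta,w)=\int_{\mathcal{R}}\frac{\rho}{\Delta t^2}\frac{\partial X}{\partial\theta}(x,\theta)^T(X(x,\theta_{--})-X(x,\theta_-))dx-\sum_{x\in\mathcal{C}}\frac{\partial X}{\partial\theta}(x,\theta)^Tv_x(\theta)w_x-\tau$, $G_\alpha=\frac1\alpha A+B$, $V_\alpha(\theta,w)=\|G_\alpha(\theta,w)\|^2$, $K(\theta)=\int_{\mathcal{R}}\frac{\rho\|X(x,\theta)-X(x,\theta_-)\|^2}{2\Delta t^2}dx$. $\mathcal{B}(\theta_-,s)$ is the closed ball of radius $s$ about $\theta_-$. First-order PGM. Fix $\eta>1$, $\epsilon>0$. Manifold projection of $\theta$ for a given $w$: repeat $\theta\leftarrow\theta^+:=\theta-\frac{\partial G_\alpha}{\partial\theta}(\theta,w)^{-1}G_\alpha(\theta,w)$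 while $\|G_\alpha(\theta,w)\|\ne0$. Initialize $w^0=0$, $\theta^0=\theta_-$, $\gamma=1$, and project $\theta^0$ with $w^0$. For $k=1,2,\dots$: with $J=\frac{\partial G_\alpha}{\partial\theta}^{-1}\frac{\partial G_\alpha}{\partial w}$ at $(\theta^{k-1},w^{k-1})$, let $\Delta w$ minimize $-\nabla K(\theta^{k-1})^TJ\Delta w+\frac12\Delta w^TJ^T\nabla^2K(\theta^{k-1})J\Delta w+\|\Delta w\|^2/\gamma$ subject to $w^{k-1}+\Delta w$ feasible; set $w^k=w^{k-1}+\Delta w$, $\theta^k=\theta^{k-1}$, and project $\theta^k$ with $w^k$. If $K(\theta^k)>K(\theta^{k-1})$, set $\gamma\leftarrow\eta\gamma$, $\theta^k\leftarrow\theta^{k-1}$, $w^k\leftarrow w^{k-1}$; otherwise $\gamma\leftarrow\gamma/\eta$, returning if $\|\theta^k-\theta^{k-1}\|_\infty<\epsilon$.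
   Formalization: The robot region is taken to be measurable and bounded, and the density measurable and bounded on it; without this the integrals defining A, B and K may diverge (e.g. region all of R^3, constant density, X = x + e^{-|x|^2}θ + |θ|^2 e_1). *)

(* Defs.v *)
From mathcomp Require Import all_boot all_order all_algebra.
From mathcomp Require Import all_classical all_reals all_analysis.
Set Implicit Arguments. Unset Strict Implicit. Unset Printing Implicit Defensive.
Import Order.TTheory GRing.Theory Num.Theory.
Import numFieldNormedType.Exports.
Local Open Scope classical_set_scope.
Local Open Scope ring_scope.

Section Calculus.
Context {R : realType}.

Definition partial {m : nat} (f : 'cV[R]_m -> R) (j : 'I_m) (z : 'cV[R]_m) : R :=
  derive1 (fun t : R => f (z + t *: delta_mx j 0)) 0.

Definition partial_exists {m : nat} (f : 'cV[R]_m -> R) (j : 'I_m) (z : 'cV[R]_m) : Prop :=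
  derivable (fun t : R => f (z + t *: delta_mx j 0)) 0 1.

Fixpoint Ck {m : nat} (k : nat) (f : 'cV[R]_m -> R) : Prop :=
  continuous f /\
  match k with
  | 0 => True
  | k'.+1 => forall j : 'I_m, (forall z, partial_exists f j z) /\ Ck k' (partial f j)
  end.

Definition Ck_mx {m p q : nat} (k : nat) (F : 'cV[R]_m -> 'M[R]_(p, q)) : Prop :=
  forall (i : 'I_p) (j : 'I_q), Ck k (fun z => F z i j).
Definition smooth_mx {m p q : nat} (F : 'cV[R]_m -> 'M[R]_(p, q)) : Prop :=
  forall k, Ck_mx k F.

Definition jac {m p : nat} (F : 'cV[R]_m -> 'cV[R]_p) (z : 'cV[R]_m) : 'M[R]_(p, m) :=
  \matrix_(i, j) partial (fun y => F y i 0) j z.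

Definition norm2sq {m : nat} (u : 'cV[R]_m) : R := \sum_i (u i 0) ^+ 2.
Definition normInf {m : nat} (u : 'cV[R]_m) : R := \big[Num.max/0]_i `|u i 0|.

Definition sigma_min {m : nat} (M : 'M[R]_m) : R :=
  inf [set Num.sqrt (norm2sq (M *m u)) | u in [set u : 'cV[R]_m | norm2sq u = 1]].

Definition L3 := ((@lebesgue_measure R \x @lebesgue_measure R) \x @lebesgue_measure R)%E.
Definition pt3 (p : R * R * R) : 'cV[R]_3 := \col_i [:: p.1.1; p.1.2; p.2]`_i.

End Calculus.

Section PGM.
Context {R : realType} {n : nat}.
Context (X : 'cV[R]_3 -> 'cV[R]_n -> 'cV[R]_3)      (* forward kinematics X(x,theta) *)
        (Rg : set 'cV[R]_3)                          (* robot region *)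
        (rho : 'cV[R]_3 -> R)
        (c : nat) (xc : 'I_c -> 'cV[R]_3)            (* contact set C = {xc i} *)
        (V : 'I_c -> nat)
        (v : forall i : 'I_c, 'cV[R]_n -> 'M[R]_(3, V i))
        (dt : R) (thm thmm tau : 'cV[R]_n).          (* Delta t, theta_-, theta_--, tau *)

Definition intR (f : 'cV[R]_3 -> R) : R :=
  \int[L3]_(p in pt3 @^-1` Rg) f (pt3 p).
Definition intmx {p q : nat} (F : 'cV[R]_3 -> 'M[R]_(p, q)) : 'M[R]_(p, q) :=
  \matrix_(i, j) intR (fun x => F x i j).

Definition dXdth (x : 'cV[R]_3) (th : 'cV[R]_n) : 'M[R]_(3, n) := jac (X x) th.

(* contact forces w = (w_x)_{x in C} *)
Definition Wt := forall i : 'I_c, 'cV[R]_(V i).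
Definition W0 : Wt := fun i => 0.
Definition Wadd (w dw : Wt) : Wt := fun i => w i + dw i.
Definition normW2 (w : Wt) : R := \sum_i norm2sq (w i).
Definition feasible (w : Wt) : Prop :=
  forall i, (forall k, 0 <= w i k 0) /\ \sum_k w i k 0 <= 1.

Definition Amap (th : 'cV[R]_n) : 'cV[R]_n :=
  intmx (fun x => (rho x / dt ^+ 2) *: ((dXdth x th)^T *m (X x th - X x thm))).
Definition Bmap (th : 'cV[R]_n) (w : Wt) : 'cV[R]_n :=
  intmx (fun x => (rho x / dt ^+ 2) *: ((dXdth x th)^T *m (X x thmm - X x thm)))
  - \sum_i ((dXdth (xc i) th)^T *m (v i th *m w i)) - tau.
Definition Gmap (alpha : R) (th : 'cV[R]_n) (w : Wt) : 'cV[R]_n :=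
  alpha^-1 *: Amap th + Bmap th w.
Definition Vmap (alpha : R) (th : 'cV[R]_n) (w : Wt) : R := norm2sq (Gmap alpha th w).
Definition Kmap (th : 'cV[R]_n) : R :=
  intR (fun x => rho x * norm2sq (X x th - X x thm) / (2 * dt ^+ 2)).

Definition Mass : 'M[R]_n :=
  intmx (fun x => (rho x / dt ^+ 2) *: ((dXdth x thm)^T *m dXdth x thm)).

Definition gradK (th : 'cV[R]_n) : 'cV[R]_n := \col_j partial Kmap j th.
Definition hessK (th : 'cV[R]_n) : 'M[R]_n :=
  \matrix_(i, j) partial (fun t => partial Kmap i t) j th.

Definition dGdth (alpha : R) (th : 'cV[R]_n) (w : Wt) : 'M[R]_n :=
  jac (fun t => Gmap alpha t w) th.
(* dG/dw applied to dw (G is affine in w, this is its linear part) *)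
Definition dGdw_apply (th : 'cV[R]_n) (dw : Wt) : 'cV[R]_n :=
  - \sum_i ((dXdth (xc i) th)^T *m (v i th *m dw i)).

Definition qobj (alpha gam : R) (th : 'cV[R]_n) (w : Wt) (dw : Wt) : R :=
  let Jdw := invmx (dGdth alpha th w) *m dGdw_apply th dw in
  - ((gradK th)^T *m Jdw) 0 0 + 2^-1 * ((Jdw^T *m hessK th *m Jdw) 0 0)
  + normW2 dw / gam.

(* manifold projection of th0 with w: Newton iterates psi, output = limit *)
Definition proj_run (alpha : R) (w : Wt) (th0 : 'cV[R]_n) (psi : nat -> 'cV[R]_n)
    (out : 'cV[R]_n) : Prop :=
  psi 0 = th0 /\
  (forall j, Gmap alpha (psi j) w = 0 -> psi j.+1 = psi j) /\
  (forall j, Gmap alpha (psi j) w <> 0 ->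
     dGdth alpha (psi j) w \in unitmx /\
     psi j.+1 = psi j - invmx (dGdth alpha (psi j) w) *m Gmap alpha (psi j) w) /\
  psi @ \oo --> out.

Definition proj_rate (alpha : R) (w : Wt) (psi : nat -> 'cV[R]_n) : Prop :=
  forall j, Gmap alpha (psi j) w <> 0 ->
    Vmap alpha (psi j.+1) w <= 3 / 4 * Vmap alpha (psi j) w.

Definition active (stop : option nat) (k : nat) : bool :=
  if stop is Some T then (k <= T)%N else true.

(* projection number k is performed with weights wproj k *)
Definition wproj (w : nat -> Wt) (dw : nat -> Wt) (k : nat) : Wt :=
  if k is k'.+1 then Wadd (w k') (dw k) else W0.

(* A run of the first-order PGM (parameters alpha, eta, eps):
   th k, w k, gam k  : iterates theta^k, w^k, gamma after iteration k
   dw k, cand k      : subproblem solution and projected candidate of iteration k >= 1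
   psi k             : Newton iterates of the k-th manifold projection (k = 0: initial)
   stop              : Some T if the algorithm returns at iteration T, None if it never returns *)
Definition returns_at (eps : R) (th : nat -> 'cV[R]_n) (cand : nat -> 'cV[R]_n) (k : nat) : Prop :=
  (0 < k)%N /\ Kmap (cand k) <= Kmap (th k.-1) /\ normInf (th k - th k.-1) < eps.

Definition pgm_run (alpha eta eps : R) (th : nat -> 'cV[R]_n) (w : nat -> Wt)
    (gam : nat -> R) (dw : nat -> Wt) (cand : nat -> 'cV[R]_n)
    (psi : nat -> nat -> 'cV[R]_n) (stop : option nat) : Prop :=
  w 0 = W0 /\ gam 0 = 1 /\ proj_run alpha W0 thm (psi 0) (th 0) /\
  (forall k, active stop k.+1 ->
     dGdth alpha (th k) (w k) \in unitmx /\
     feasible (Wadd (w k) (dw k.+1)) /\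
     (forall d', feasible (Wadd (w k) d') ->
        qobj alpha (gam k) (th k) (w k) (dw k.+1) <= qobj alpha (gam k) (th k) (w k) d') /\
     proj_run alpha (Wadd (w k) (dw k.+1)) (th k) (psi k.+1) (cand k.+1) /\
     (Kmap (cand k.+1) > Kmap (th k) ->
        gam k.+1 = eta * gam k /\ th k.+1 = th k /\ w k.+1 = w k) /\
     (Kmap (cand k.+1) <= Kmap (th k) ->
        gam k.+1 = gam k / eta /\ th k.+1 = cand k.+1 /\ w k.+1 = Wadd (w k) (dw k.+1))) /\
  (if stop is Some T then returns_at eps th cand T /\
                          (forall k, (k < T)%N -> ~ returns_at eps th cand k)
   else forall k, ~ returns_at eps th cand k).

End PGM.

(* Main.v *)
(** Near [thm] the Jacobian of [alpha *: Gmap] is [Mass] up to an error that is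
    small uniformly in [alpha] and in the feasible weights, because [Mass] is the
    Jacobian of [Amap] at [thm] and the other terms carry a factor [alpha].  By (A2)
    [Mass] is bounded below, so on a fixed box about [thm] each Newton step contracts
    [Gmap] by a fixed factor, and every zero of [Gmap] in the box is at distance
    O(alpha) from [thm].  Feasible weights are bounded and [Amap] does not depend on
    them, so changing the weights at such a zero makes [Gmap] only O(1) and moves the
    next projection by O(alpha): by induction all iterates are zeros of [Gmap] at
    distance O(alpha) from [thm], whatever the acceptance test on [Kmap] decides. *)
Require Import Defs.
From mathcomp Require Import all_boot all_order all_algebra.
From mathcomp Require Import all_classical all_reals all_analysis.
From mathcomp Require Import measurable_realfun ring lra.
Import Order.TTheory GRing.Theory Num.Theory.
Import numFieldNormedType.Exports.
Local Open Scope classical_set_scope.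
Local Open Scope ring_scope.

Set Implicit Arguments.
Unset Strict Implicit.
Unset Printing Implicit Defensive.

(** Regularity is stated through iterated partial derivatives, so increments are estimated one
    coordinate at a time. This suits the sup norm, whose balls are boxes; the Euclidean norm enters
    only through comparisons that cost factors of [n]. The density is merely measurable and bounded,
    so each integrand is a weight in [x] times a function continuous in [(x, th)]; compactness makes
    the estimates uniform over the bounded region, and this uniformity gives continuity and
    differentiability of the integrals. Newton's method is controlled to first order: closeness of
    the Jacobian to one fixed matrix gives linear contraction. A projection is the full limit of its
    Newton iterates, so every [theta^k] is an exact zero; its distance to [thm] is read off from the
    value of [Gmap] at [thm], independently of where the projection started, and errors do not
    accumulate over the iterations. Since runs must also be shown to exist, each subproblem needs a
    minimizer, again obtained by compactness. *)

Section ContinuousArithmetic.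
Context {R : realType} {T : topologicalType}.
Implicit Types f g : T -> R.

Lemma continuous_addf f g :
  continuous f -> continuous g -> continuous (fun y => f y + g y).
Proof. by move=> cf cg z; apply: continuousD; [exact: cf|exact: cg]. Qed.

Lemma continuous_mulf f g :
  continuous f -> continuous g -> continuous (fun y => f y * g y).
Proof. by move=> cf cg z; apply: continuousM; [exact: cf|exact: cg]. Qed.

Lemma continuous_oppf f : continuous f -> continuous (fun y => - f y).
Proof. by move=> cf z; apply: continuousN; exact: cf. Qed.

Lemma continuous_sumf {I : Type} (s : seq I) (F : I -> T -> R) :
  (forall i, continuous (F i)) -> continuous (fun y => \sum_(i <- s) F i y).
Proof.
move=> cF; elim: s => [|i s IHs].
  rewrite (_ : (fun y => _) = fun=> 0); first exact: cst_continuous.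
  by apply/funext => y; rewrite big_nil.
rewrite (_ : (fun y => _) = fun y => F i y + \sum_(i <- s) F i y).
  exact: continuous_addf.
by apply/funext => y; rewrite big_cons.
Qed.

End ContinuousArithmetic.

(** * Functions with continuous partial derivatives *)

Section C1Functions.
Context {R : realType} {m : nat}.
Implicit Types (f g : 'cV[R]_m -> R) (P : pred 'I_m) (j : 'I_m) (z : 'cV[R]_m).

Definition is_partial f j z (a : R) : Prop :=
  is_derive (0 : R) (1 : R) (fun t : R => f (z + t *: delta_mx j 0)) a.

Lemma is_partialP f j z : partial_exists f j z -> is_partial f j z (partial f j z).
Proof. by move=> df; rewrite /is_partial /partial derive1E; exact: derivableP. Qed.

Lemma is_partialE f j z a :
  is_partial f j z a -> partial_exists f j z /\ partial f j z = a.
Proof. by case=> df dfa; rewrite /partial derive1E. Qed.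

(** The predicate selects the coordinates of differentiation: functions of the joint variable
    [(x, th)] are differentiated in the coordinates of [th] only. *)
Definition C1on P f : Prop :=
  continuous f /\
  forall j, P j -> (forall z, partial_exists f j z) /\ continuous (partial f j).

Lemma C1onI P f (df : 'I_m -> 'cV[R]_m -> R) : continuous f ->
  (forall j z, P j -> is_partial f j z (df j z)) ->
  (forall j, P j -> continuous (df j)) -> C1on P f.
Proof.
move=> cf dfP cdf; split=> // j Pj; split=> [z|].
  by have [] := is_partialE (dfP j z Pj).
rewrite (_ : partial f j = df j); first exact: cdf.
by apply/funext => z; have [] := is_partialE (dfP j z Pj).
Qed.

Lemma C1on_is_partial P f j z : C1on P f -> P j -> is_partial f j z (partial f j z).
Proof. by move=> [_ Cf] Pj; apply: is_partialP; have [] := Cf j Pj. Qed.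

Lemma is_partialD f g j z a b : is_partial f j z a -> is_partial g j z b ->
  is_partial (fun y => f y + g y) j z (a + b).
Proof. by move=> fa gb; apply: is_deriveD. Qed.

Lemma is_partialM f g j z a b : is_partial f j z a -> is_partial g j z b ->
  is_partial (fun y => f y * g y) j z (f z * b + g z * a).
Proof.
move=> fa gb.
have := is_deriveM fa gb.
by rewrite !scale0r !addr0.
Qed.

Lemma is_partial_cst (c : R) j z : is_partial (fun=> c) j z 0.
Proof. exact: is_derive_cst. Qed.

Lemma is_partial_sum {I : Type} (s : seq I) (F : I -> 'cV[R]_m -> R) j z
    (a : I -> R) :
  (forall i, is_partial (F i) j z (a i)) ->
  is_partial (fun y => \sum_(i <- s) F i y) j z (\sum_(i <- s) a i).
Proof.
move=> Fa; elim: s => [|i s IHs].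
  rewrite big_nil (_ : (fun y => _) = fun=> 0); first exact: is_partial_cst.
  by apply/funext => y; rewrite big_nil.
rewrite big_cons (_ : (fun y => _) = fun y => F i y + \sum_(i <- s) F i y).
  exact: is_partialD.
by apply/funext => y; rewrite big_cons.
Qed.

Lemma is_partialZ (c : R) f j z a :
  is_partial f j z a -> is_partial (fun y => c * f y) j z (c * a).
Proof.
move=> fa; have := is_partialM (is_partial_cst c j z) fa.
by rewrite mulr0 addr0.
Qed.

Lemma C1on_cst P (c : R) : C1on P (fun=> c).
Proof.
apply: (C1onI (df := fun _ _ => 0)) => [|j z _|j _]; [|exact: is_partial_cst|];
  exact: cst_continuous.
Qed.

Lemma C1onD P f g : C1on P f -> C1on P g -> C1on P (fun y => f y + g y).
Proof.
move=> Cf Cg.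
apply: (C1onI (df := fun j z => partial f j z + partial g j z)).
- by apply: continuous_addf; [exact: Cf.1|exact: Cg.1].
- by move=> j z Pj; apply: is_partialD; apply: C1on_is_partial; eassumption.
- by move=> j Pj; apply: continuous_addf; [exact: (Cf.2 j Pj).2|exact: (Cg.2 j Pj).2].
Qed.

Lemma C1onM P f g : C1on P f -> C1on P g -> C1on P (fun y => f y * g y).
Proof.
move=> Cf Cg.
apply: (C1onI (df := fun j z => f z * partial g j z + g z * partial f j z)).
- by apply: continuous_mulf; [exact: Cf.1|exact: Cg.1].
- by move=> j z Pj; apply: is_partialM; apply: C1on_is_partial; eassumption.
- move=> j Pj; apply: continuous_addf; apply: continuous_mulf.
  + exact: Cf.1.
  + exact: (Cg.2 j Pj).2.
  + exact: Cg.1.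
  + exact: (Cf.2 j Pj).2.
Qed.

Lemma C1on_sum {I : Type} P (s : seq I) (F : I -> 'cV[R]_m -> R) :
  (forall i, C1on P (F i)) -> C1on P (fun y => \sum_(i <- s) F i y).
Proof.
move=> CF; elim: s => [|i s IHs].
  rewrite (_ : (fun y => _) = fun=> 0); first exact: C1on_cst.
  by apply/funext => y; rewrite big_nil.
rewrite (_ : (fun y => _) = fun y => F i y + \sum_(i <- s) F i y).
  exact: C1onD.
by apply/funext => y; rewrite big_cons.
Qed.

Lemma Ck_C1on k P f : Ck k.+1 f -> C1on P f.
Proof. by move=> [cf df]; split=> // j _; case: k df => [|k] /(_ j)[? []]. Qed.

Lemma Ck_partial_C1on k P f j : Ck k.+2 f -> C1on P (partial f j).
Proof. by move=> [_ /(_ j)[_]]; exact: Ck_C1on. Qed.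

(* [a] plays the role of an approximate value of the gradient over the box. *)
Lemma coord_increment P f j z (d a e : R) :
  C1on P f -> P j ->
  (forall t : R, 0 <= t <= d \/ d <= t <= 0 ->
    `|partial f j (z + t *: delta_mx j 0) - a| <= e) ->
  `|f (z + d *: delta_mx j 0) - f z - a * d| <= e * `|d|.
Proof.
move=> Cf Pj hb.
pose dp : R -> R := fun t => partial f j (z + t *: delta_mx j 0).
(* With the linear part [a * t] subtracted, the mean value theorem bounds the increment by the
   deviation of the derivative from [a]. *)
have dg (t : R) : is_derive t (1 : R) (fun t : R => f (z + t *: delta_mx j 0) - a * t)
    (dp t - a).
  apply: is_deriveB.
    (* [h] is a derivative at 0 from a shifted base point; composing with the shift by [- t] turns
       it into a derivative at [t]. *)
    have h := C1on_is_partial (z + t *: delta_mx j 0) Cf Pj.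
    rewrite /is_partial in h.
    have s : is_derive t (1 : R) (shift (- t)) 1 by exact: is_derive_shift.
    rewrite -(subrr t) in h.
    have := is_derive1_comp (g := shift (- t)) h s.
    rewrite mulr1.
    rewrite (_ : _ \o _ = fun t : R => f (z + t *: delta_mx j 0)) //.
    by apply/funext => u /=; rewrite -addrA -scalerDl addrCA subrr addr0.
  by apply: is_derive_eq; rewrite /GRing.scale /= mulr1.
have cg : continuous (fun t : R => f (z + t *: delta_mx j 0) - a * t).
  by move=> t; apply/differentiable_continuous/derivable1_diffP; case: (dg t).
have scaled (p q : R) : `|p| <= e -> `|p * q| <= e * `|q|.
  by move=> pe; rewrite normrM ler_wpM2r.
have [d0|d0] := leP 0 d.
  have [y] := MVT_segment d0 (fun t _ => dg t) (continuous_subspaceT cg).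
  rewrite in_itv /= => /andP[y0 yd].
  rewrite scale0r addr0 mulr0 !subr0 => E.
  rewrite [X in `|X|](_ : _ = (dp y - a) * d).
    2: by rewrite -E; ring.
  by apply: scaled; apply: hb; left; rewrite y0.
have [y] := MVT_segment (ltW d0) (fun t _ => dg t) (continuous_subspaceT cg).
rewrite in_itv /= => /andP[dy y0].
rewrite scale0r addr0 mulr0 subr0 sub0r => E.
rewrite (_ : f _ - f z - a * d = (dp y - a) * d).
  by apply: scaled; apply: hb; right; rewrite dy.
have {}E : f z - (f (z + d *: delta_mx j 0) - a * d) = (dp y - a) * - d := E.
by apply: oppr_inj; rewrite -[RHS]mulrN -E; ring.
Qed.
End C1Functions.

(** * The sup norm and its comparison with the Euclidean norm *)

Section SupNorm.
Context {R : realType} {m : nat}.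
Implicit Types (u : 'cV[R]_m).

Lemma cvnorm_leP u e : 0 <= e -> `|u| <= e <-> forall i, `|u i 0| <= e.
Proof.
move=> e0; have normE : `|u| = mx_norm u by [].
rewrite normE mx_normrE; split=> [ue i|ue].
  apply: le_trans ue.
  exact: (le_bigmax 0 (fun ij : 'I_m * 'I_1 => `|u ij.1 ij.2|) (i, 0)).
by apply/bigmax_leP; split=> // -[i j] _ /=; rewrite ord1.
Qed.

Lemma cvnorm_coord u i : `|u i 0| <= `|u|.
Proof. exact: (cvnorm_leP u (normr_ge0 u)).1 (lexx _) i. Qed.

Lemma norm2sq_le_sup u : norm2sq u <= m%:R * `|u| ^+ 2.
Proof.
rewrite /norm2sq mulr_natl -[X in _ *+ X]card_ord -sumr_const.
apply: ler_sum => i _; rewrite -real_normK ?num_real //.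
by rewrite lerXn2r ?nnegrE ?cvnorm_coord.
Qed.

Lemma norm2sq_ge_sup u : `|u| ^+ 2 <= norm2sq u.
Proof.
have S0 : 0 <= norm2sq u by apply: sumr_ge0 => i _; rewrite sqr_ge0.
rewrite -[leRHS]sqr_sqrtr // lerXn2r ?nnegrE ?sqrtr_ge0 //.
apply/(cvnorm_leP _ (sqrtr_ge0 _)) => i.
rewrite -sqrtr_sqr ler_sqrt ?sqr_ge0 //.
rewrite /norm2sq (bigD1 i) //= lerDl.
by apply: sumr_ge0 => k _; rewrite sqr_ge0.
Qed.

End SupNorm.

Lemma cvnorm_mulmx {R : realType} {m p : nat} (A : 'M[R]_(p, m)) (u : 'cV[R]_m) e :
  0 <= e -> (forall i j, `|A i j| <= e) -> `|A *m u| <= m%:R * e * `|u|.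
Proof.
move=> e0 Ae; have b0 : 0 <= m%:R * e * `|u| by rewrite !mulr_ge0.
apply/(cvnorm_leP _ b0) => i.
rewrite mxE (le_trans (ler_norm_sum _ _ _)) //.
rewrite -mulrA mulr_natl -[X in _ *+ X]card_ord -sumr_const.
by apply: ler_sum => j _; rewrite normrM ler_pM ?cvnorm_coord.
Qed.

(* Passing from [x] to [y] one coordinate at a time stays inside the box. *)
Lemma box_increment {R : realType} {m : nat} (f : 'cV[R]_m -> R) (c : 'cV[R]_m) (r e : R) (a : 'I_m -> R) x y :
  C1on predT f -> 0 <= e ->
  (forall z, `|z - c| <= r -> forall j, `|partial f j z - a j| <= e) ->
  `|x - c| <= r -> `|y - c| <= r ->
  `|f y - f x - \sum_j a j * (y - x) j 0| <= m%:R * e * `|y - x|.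
Proof.
move=> Cf e0 Da xr yr.
have r0 : 0 <= r := le_trans (normr_ge0 _) xr.
pose h k : 'cV[R]_m := \col_i if (i < k)%N then y i 0 else x i 0.
have step k : (k <= m)%N ->
    `|f (h k) - f x - \sum_(j < m | (j < k)%N) a j * (y - x) j 0| <=
    k%:R * e * `|y - x|.
  elim: k => [_|k IHk km].
    rewrite big_pred0 // (_ : h 0%N = x) ?subrr ?subr0 ?normr0 ?mul0r //.
    by apply/colP => i; rewrite mxE.
  pose j0 := Ordinal km.
  have hS : h k.+1 = h k + (y - x) j0 0 *: delta_mx j0 0.
    apply/colP => i; rewrite !mxE eqxx andbT ltnS leq_eqVlt.
    case: (eqVneq i j0) => [->|ij0] /=.
      by rewrite eqxx ltnn mulr1 addrCA subrr addr0.
    rewrite mulr0 addr0; case: eqP => //= ik; case/eqP: ij0.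
    exact: val_inj.
  rewrite (bigD1 j0) //= (eq_bigl (fun j : 'I_m => (j < k)%N)); last first.
    move=> j; rewrite ltnS leq_eqVlt -val_eqE /=.
    by case: (eqVneq (j : nat) k) => [->|]; rewrite ?ltnn ?andbT.
  have IH := IHk (ltnW km).
  have inc : `|f (h k.+1) - f (h k) - a j0 * (y - x) j0 0| <= e * `|(y - x) j0 0|.
    rewrite hS; apply: (coord_increment Cf) => // t tle.
    (* Only coordinate [j0] moves, between its values in [x] and in [y], and both lie within [r] of
       the center. *)
    apply: Da; apply/(cvnorm_leP _ r0) => i; rewrite !mxE eqxx andbT.
    have := (cvnorm_leP (y - c) r0).1 yr i; have := (cvnorm_leP (x - c) r0).1 xr i.
    rewrite !mxE; case: (eqVneq i j0) => [->|ij0] /=; last first.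
      by rewrite mulr0 addr0; case: ifP => _.
    rewrite ltnn mulr1 !ler_norml => /andP[x1 x2] /andP[y1 y2].
    by move: tle; rewrite !mxE; case=> /andP[t1 t2]; apply/andP; split; lra.
  have le1 : e * `|(y - x) j0 0| <= e * `|y - x| by rewrite ler_wpM2l // cvnorm_coord.
  set S := \sum_(j < m | _) _ in IH *.
  rewrite (_ : _ - (_ + S) = (f (h k.+1) - f (h k) - a j0 * (y - x) j0 0)
    + (f (h k) - f x - S)); last by ring.
  apply: (le_trans (ler_normD _ _)).
  rewrite -natr1 !mulrDl mul1r [leLHS]addrC.
  by apply: lerD; [exact: IH|exact: (le_trans inc le1)].
have := step m (leqnn m).
rewrite (_ : h m = y); last by apply/colP => i; rewrite mxE ltn_ord.
by under eq_bigl do rewrite ltn_ord.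
Qed.

(** * Newton's method for a map whose Jacobian is close to a fixed matrix *)

Section Newton.
Context {R : realType} {n : nat}.
Variables (G : 'cV[R]_n -> 'cV[R]_n) (M : 'M[R]_n) (c : 'cV[R]_n) (r kap e : R).

Definition newton (z : 'cV[R]_n) : 'cV[R]_n := z - invmx (jac G z) *m G z.

Hypothesis e_ge0 : 0 <= e.
Hypothesis kap_ge0 : 0 <= kap.
Hypothesis M_lower : forall u : 'cV[R]_n, `|u| <= kap * `|M *m u|.
Hypothesis C1G : forall i, C1on predT (fun y => G y i 0).
Hypothesis jac_near : forall z, `|z - c| <= r -> forall i j, `|jac G z i j - M i j| <= e.
(** [kap] bounds the inverse of [M] and [n%:R * e] bounds the Jacobian error as an operator, so
    their product is a relative error. The 8 makes a Newton step halve the sup norm of [G]; the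
    [n.+1] pays for the passage to the Euclidean norm in [newton_rate]. *)
Hypothesis small : 8 * n.+1%:R * (kap * (n%:R * e)) <= 1.

Let ke := kap * (n%:R * e).

Lemma ke_ge0 : 0 <= ke.
Proof. by rewrite !mulr_ge0. Qed.

Lemma ke_le8 : 8 * ke <= 1.
Proof.
apply: le_trans small; rewrite -mulrA ler_pM2l // -[leLHS]mul1r.
by rewrite ler_wpM2r ?ke_ge0 // ler1n.
Qed.

Lemma affine_approx x y : `|x - c| <= r -> `|y - c| <= r ->
  `|G y - G x - M *m (y - x)| <= n%:R * e * `|y - x|.
Proof.
move=> xr yr.
have b0 : 0 <= n%:R * e * `|y - x| by rewrite !mulr_ge0.
apply/(cvnorm_leP _ b0) => i.
have := box_increment (a := fun j => M i j) (C1G i) e_ge0 _ xr yr.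
rewrite !mxE; apply => z zr j.
by have := jac_near zr i j; rewrite mxE.
Qed.

(** Replacing [M] by the Jacobian costs [ke * |u| <= |u| / 8], which is absorbed on the left; the
    resulting factor [8 / 7] is rounded up to 2. *)
Lemma jac_lower z (u : 'cV[R]_n) : `|z - c| <= r -> `|u| <= 2 * kap * `|jac G z *m u|.
Proof.
move=> zr; have d0 := cvnorm_mulmx u e_ge0 (A := jac G z - M).
have {d0}d : `|(jac G z - M) *m u| <= n%:R * e * `|u|.
  by apply: d0 => i j; rewrite !mxE; have := jac_near zr i j; rewrite mxE.
have Mu : `|M *m u| <= `|jac G z *m u| + n%:R * e * `|u|.
  have -> : M *m u = jac G z *m u - (jac G z - M) *m u by rewrite mulmxBl subKr.
  by apply: (le_trans (ler_normB _ _)); rewrite lerD2l.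
have h1 := le_trans (M_lower u) (ler_wpM2l kap_ge0 Mu).
have h2 : ke * `|u| <= 8^-1 * `|u|.
  by rewrite ler_wpM2r //; have := ke_le8; lra.
move: h1; rewrite mulrDr (mulrA kap (_ * _)) -/ke => h1.
by rewrite -mulrA; have := normr_ge0 u; lra.
Qed.

(** [jac_lower] makes the right kernel trivial; the transposition is there because [kermx] is a left
    kernel. *)
Lemma jac_unit z : `|z - c| <= r -> jac G z \in unitmx.
Proof.
move=> zr; rewrite -unitmx_tr -row_free_unit -kermx_eq0; apply/eqP/row_matrixP => i.
rewrite row0; set u := row i _.
have hu : jac G z *m u^T = 0.
  by rewrite -[jac G z]trmxK -trmx_mul -row_mul mulmx_ker row0 trmx0.
have := jac_lower u^T zr; rewrite hu normr0 mulr0 normr_le0 => /eqP h.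
by rewrite -[u]trmxK h trmx0.
Qed.

Lemma newton_dist z : `|z - c| <= r -> `|newton z - z| <= 2 * kap * `|G z|.
Proof.
move=> zr; have := jac_lower (newton z - z) zr.
rewrite /newton addrAC subrr add0r mulmxN normrN mulmxA mulmxV ?jac_unit //.
by rewrite mul1mx normrN.
Qed.

(** The step [s] solves [jac G z *m s = - G z], so [G (newton z)] is the affine error with slope [M]
    minus [(jac G z - M) *m s]. Each is at most [n%:R * e * |s|], and [|s| <= 2 * kap * |G z|]. *)
Lemma newton_contract z : `|z - c| <= r -> `|newton z - c| <= r ->
  `|G (newton z)| <= 4 * ke * `|G z|.
Proof.
move=> zr nr; have A := affine_approx zr nr.
have d := newton_dist zr.
pose s := newton z - z.
have Js : jac G z *m s = - G z.
  by rewrite /s /newton addrAC subrr add0r mulmxN mulmxA mulmxV ?jac_unit ?mul1mx.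
have B : `|(jac G z - M) *m s| <= n%:R * e * `|s|.
  by apply: cvnorm_mulmx => // i j; rewrite !mxE; have := jac_near zr i j; rewrite mxE.
have -> : G (newton z) = (G (newton z) - G z - M *m s) - (jac G z - M) *m s.
  by rewrite mulmxBl Js opprB addrA subrK opprK subrK.
apply: (le_trans (ler_normB _ _)).
have C : n%:R * e * `|s| <= n%:R * e * (2 * kap * `|G z|) by rewrite ler_wpM2l ?mulr_ge0.
apply: (le_trans (lerD A B)); apply: (le_trans (lerD C C)).
by rewrite /ke; lra.
Qed.

(** The affine approximation based at [c], inverted by [M_lower]. For a zero [z] it bounds the
    distance by the value at the center alone. *)
Lemma dist_center z : `|c - c| <= r -> `|z - c| <= r ->
  `|z - c| <= 2 * kap * (`|G z| + `|G c|).
Proof.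
move=> cr zr; have A := affine_approx cr zr.
have Mu : `|M *m (z - c)| <= `|G z| + `|G c| + n%:R * e * `|z - c|.
  have -> : M *m (z - c) = G z - G c - (G z - G c - M *m (z - c)) by rewrite subKr.
  apply: (le_trans (ler_normB _ _)); apply: lerD => //; exact: ler_normB.
have h1 := le_trans (M_lower (z - c)) (ler_wpM2l kap_ge0 Mu).
have h2 : ke * `|z - c| <= 8^-1 * `|z - c|.
  by rewrite ler_wpM2r //; have := ke_le8; lra.
move: h1; rewrite mulrDr (mulrA kap (_ * _)) -/ke => h1.
by rewrite -mulrA; have := normr_ge0 (z - c); lra.
Qed.

Section Iteration.
Variable psi : nat -> 'cV[R]_n.
Hypothesis psiS : forall j, psi j.+1 = newton (psi j).
(** Steps have length at most [2 * kap * |G (psi j)|] and [|G (psi j)|] halves each time, so the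
    geometric series bounds the whole path by [4 * kap * |G (psi 0)|]. *)
Hypothesis start : `|psi 0 - c| + 4 * kap * `|G (psi 0)| <= r.

(** The two bounds need a joint induction: contraction requires both endpoints of the step in the
    box, and staying in the box requires the earlier contractions. The factor [1 - 2^-1 ^+ j] is the
    partial geometric sum. *)
Lemma newton_iterates j :
  `|psi j - psi 0| <= 4 * kap * `|G (psi 0)| * (1 - 2^-1 ^+ j) /\
  `|G (psi j)| <= 2^-1 ^+ j * `|G (psi 0)|.
Proof.
set g := `|G (psi 0)|; have g0 : 0 <= g by exact: normr_ge0.
have kg : 0 <= kap * g by exact: mulr_ge0.
have inbox y t : t <= 1 -> `|y - psi 0| <= 4 * kap * g * t -> `|y - c| <= r.
  move=> t1 yt; have -> : y - c = (y - psi 0) + (psi 0 - c) by rewrite addrA subrK.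
  apply: (le_trans (ler_normD _ _)); apply: le_trans start.
  rewrite addrC lerD2l; apply: (le_trans yt).
  by rewrite -[leRHS]mulr1 ler_wpM2l // -mulrA mulr_ge0.
elim: j => [|j [IH1 IH2]]; first by rewrite !expr0 subrr subrr normr0 mulr0 mul1r.
rewrite exprS psiS.
have : (0 : R) <= 2^-1 ^+ j by rewrite exprn_ge0.
move: (2^-1 ^+ j) IH1 IH2 => p IH1 IH2 p0.
have jr : `|psi j - c| <= r by apply: inbox IH1; rewrite lerBlDr lerDl.
have d := newton_dist jr.
have h1 : 2 * kap * `|G (psi j)| <= 2 * kap * (p * g).
  by rewrite ler_wpM2l // mulr_ge0.
have D : `|newton (psi j) - psi 0| <= 4 * kap * g * (1 - 2^-1 * p).
  have -> : newton (psi j) - psi 0 = (newton (psi j) - psi j) + (psi j - psi 0).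
    by rewrite addrA subrK.
  apply: (le_trans (ler_normD _ _)); apply: (le_trans (lerD d IH1)).
  by apply: (le_trans (lerD h1 (lexx _))); rewrite le_eqVlt; apply/orP; left; apply/eqP; field.
split=> //.
have Sr : `|newton (psi j) - c| <= r.
  by apply: inbox D; rewrite lerBlDr lerDl mulr_ge0.
apply: (le_trans (newton_contract jr Sr)).
rewrite -[leRHS]mulrA; apply: ler_pM => //; first by rewrite mulr_ge0 ?ke_ge0.
by have := ke_le8; lra.
Qed.

Lemma newton_iterates_box j : `|psi j - c| <= r.
Proof.
have [d _] := newton_iterates j.
have -> : psi j - c = (psi j - psi 0) + (psi 0 - c) by rewrite addrA subrK.
apply: (le_trans (ler_normD _ _)); apply: le_trans start.
rewrite addrC lerD2l; apply: (le_trans d).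
by rewrite -[leRHS]mulr1 ler_wpM2l ?mulr_ge0 // lerBlDr lerDl exprn_ge0.
Qed.

(** Going through the sup norm costs a factor [n]: the ratio is at most
    [n * (4 * ke) ^+ 2 = 16 * (n * ke) * ke], and both [n * ke] and [ke] are at most [1 / 8], which
    gives [1 / 4]. *)
Lemma newton_rate j : norm2sq (G (psi j.+1)) <= 3 / 4 * norm2sq (G (psi j)).
Proof.
have := newton_contract (newton_iterates_box j).
rewrite -psiS => /(_ (newton_iterates_box _)) C.
apply: (le_trans (norm2sq_le_sup _)).
have C2 : `|G (psi j.+1)| ^+ 2 <= (4 * ke * `|G (psi j)|) ^+ 2.
  by rewrite lerXn2r ?nnegrE // ?mulr_ge0 ?ke_ge0.
apply: (le_trans (ler_wpM2l (ler0n _ _) C2)).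
rewrite exprMn mulrA; apply: ler_pM (norm2sq_ge_sup _); rewrite ?mulr_ge0 ?sqr_ge0 //.
have k0 := ke_ge0; have k8 := ke_le8.
have nk : n%:R * ke <= 8^-1.
  have : n%:R * ke <= n.+1%:R * ke by rewrite ler_wpM2r // ler_nat.
  by move: small; rewrite -/ke; lra.
have -> : n%:R * (4 * ke) ^+ 2 = 16 * (n%:R * ke) * ke by ring.
have : (n%:R * ke) * ke <= 8^-1 * 8^-1.
  by apply: ler_pM => //; [rewrite mulr_ge0|lra].
lra.
Qed.

Lemma newton_limit (out : 'cV[R]_n) : psi @ \oo --> out ->
  `|out - psi 0| <= 4 * kap * `|G (psi 0)| /\ G out = 0.
Proof.
move=> po; split.
  apply/ler_addgt0Pr => eps eps0.
  have [j /= hj] := filter_ex ((cvgrPdist_lt _ _).1 po eps eps0).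
  have -> : out - psi 0 = (out - psi j) + (psi j - psi 0) by rewrite addrA subrK.
  apply: (le_trans (ler_normD _ _)); rewrite addrC; apply: lerD (ltW hj).
  have [d _] := newton_iterates j; apply: (le_trans d).
  by rewrite -[leRHS]mulr1 ler_wpM2l ?mulr_ge0 // lerBlDr lerDl exprn_ge0.
apply/colP => i; rewrite mxE.
have Gp : (fun j => G (psi j) i 0) @ \oo --> G out i 0.
  exact: continuous_cvg ((C1G i).1 out) po.
have G0 : (fun j => G (psi j) i 0) @ \oo --> (0 : R).
  have q : (geometric `|G (psi 0)| 2^-1 : nat -> R) @ \oo --> (0 : R).
    by apply: cvg_geometric; rewrite ger0_norm // invf_lt1 // ltr1n.
  apply: norm_cvg0.
  apply: (squeeze_cvgr _ (cvg_cst 0) q); near=> j.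
  rewrite normr_ge0 /=; apply: (le_trans (cvnorm_coord _ _)).
  by rewrite mulrC; have [] := newton_iterates j.
exact: cvg_unique Gp G0.
Unshelve. all: by end_near. Qed.

(** The step bounds telescope; [newton_cvg] reads the Cauchy property from this tail. *)
Lemma newton_tail j k :
  `|psi (j + k) - psi j| <= 4 * kap * `|G (psi 0)| * (2^-1 ^+ j - 2^-1 ^+ (j + k)).
Proof.
elim: k => [|k IHk]; first by rewrite addn0 !subrr normr0 mulr0.
have d := newton_dist (newton_iterates_box (j + k)).
have [_ h] := newton_iterates (j + k).
rewrite addnS psiS exprS.
have -> : newton (psi (j + k)) - psi j =
  (newton (psi (j + k)) - psi (j + k)) + (psi (j + k) - psi j) by rewrite addrA subrK.
apply: (le_trans (ler_normD _ _)); apply: (le_trans (lerD d IHk)).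
have h1 : 2 * kap * `|G (psi (j + k))| <= 2 * kap * (2^-1 ^+ (j + k) * `|G (psi 0)|).
  by rewrite ler_wpM2l // mulr_ge0.
apply: (le_trans (lerD h1 (lexx _))).
move: (2^-1 ^+ (j + k)) (2^-1 ^+ j) => p q.
by rewrite le_eqVlt; apply/orP; left; apply/eqP; field.
Qed.

Lemma newton_cvg : exists out : 'cV[R]_n, psi @ \oo --> out.
Proof.
suff cpsi : cauchy (psi @ \oo).
  by move: cpsi => /cauchy_cvg/cvg_ex [out po]; exists out.
apply: cauchy_exP => eps eps0.
set C := 4 * kap * `|G (psi 0)|.
have q : (geometric C 2^-1 : nat -> R) @ \oo --> (0 : R).
  by apply: cvg_geometric; rewrite ger0_norm // invf_lt1 // ltr1n.
have [j /= hj] := filter_ex ((cvgr0Pnorm_lt _).1 q eps eps0).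
exists (psi j); exists j => // k /= jk.
rewrite -ball_normE /= distrC -(subnKC jk).
apply: le_lt_trans hj; apply: (le_trans (newton_tail j _)).
apply: le_trans (ler_norm _); rewrite ler_wpM2l ?mulr_ge0 //.
by rewrite lerBlDr lerDl exprn_ge0.
Qed.

End Iteration.
End Newton.

(** * Measurability of functions measurable in one variable and continuous in the other *)

Section Caratheodory.
Context {R : realType} d (T : measurableType d).

(* Approximates [g] by functions that are constant in [y] on the cells
   [floor (k y) = z]. *)
Lemma measurable_fun_caratheodory (g : T * R -> R) :
  (forall y : R, measurable_fun setT (fun x => g (x, y))) ->
  (forall x, continuous (fun y : R => g (x, y))) ->
  measurable_fun setT g.
Proof.
move=> mg cg.
pose a (k : nat) (y : R) : R := (Num.floor (y * k.+1%:R))%:~R / k.+1%:R.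
apply: (@measurable_fun_cvg _ _ _ setT (fun k p => g (p.1, a k p.2))) => [k|[x y] _].
  move=> _ B mB; rewrite setTI.
  (* The approximant depends on [y] only through its cell, so a preimage is a countable union of
     measurable rectangles. *)
  pose cell (z : int) : set R := `[z%:~R / k.+1%:R, (z + 1)%:~R / k.+1%:R[%classic.
  have -> : (fun p : T * R => g (p.1, a k p.2)) @^-1` B =
      \bigcup_(z : int) (((fun x => g (x, z%:~R / k.+1%:R)) @^-1` B) `*` cell z).
    apply/seteqP; split=> [[x y] /= Bxy|[x y] [z _] [/= Bxz]].
      exists (Num.floor (y * k.+1%:R)) => //=; split => //=.
      rewrite /cell /= in_itv /= ler_pdivrMr ?ltr_pdivlMr ?ltr0Sn //.
      exact: floor_itv.
    rewrite /cell /= in_itv /= ler_pdivrMr ?ltr_pdivlMr ?ltr0Sn // => /floor_def zE.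
    by rewrite /a zE.
  apply: countable_bigcupT_measurable => // z.
  apply: measurableX; first by rewrite -[X in measurable X]setTI; exact: mg.
  exact: measurable_itv.
have ay : (a k y) @[k --> \oo] --> y.
  apply/cvgrPdist_le => e e0; near=> k.
  have k0 : (0 : R) < k.+1%:R by rewrite ltr0Sn.
  have /andP[h1 h2] := floor_itv (y * k.+1%:R).
  have hk : e^-1 <= k.+1%:R.
    near: k; exists (Num.truncn e^-1) => // j /= hj.
    apply: ltW; apply: (lt_le_trans (truncnS_gt _)); by rewrite ler_nat ltnS.
  rewrite /a ger0_norm; last by rewrite subr_ge0 ler_pdivrMr.
  rewrite lerBlDr -(ler_pM2r k0) mulrDl divfK ?gt_eqF // addrC.
  rewrite intrD in h2; apply: (le_trans (ltW h2)); rewrite lerD2l.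
  by rewrite mulr1z -ler_pdivrMl // mulr1.
by apply: (continuous_cvg _ (cg x y) ay).
Unshelve. all: by end_near.
Qed.
End Caratheodory.

(** * Measurability of continuous functions on three-space *)

Section R3.
Context {R : realType}.

Lemma cv_continuous {T : topologicalType} {m : nat} (F : T -> 'cV[R]_m) :
  (forall i, continuous (fun t => F t i 0)) -> continuous F.
Proof.
move=> cF t A [P nP sPA].
have : \forall s \near t, forall i, P i 0 (F s i 0).
  by apply: filter_forall => i; apply: cF; exact: nP.
by apply: filterS => s Ps; apply: sPA => i j; rewrite ord1.
Qed.

Lemma pt3_continuous : continuous (@pt3 R).
Proof.
apply: cv_continuous => -[[|[|[|//]]] i3] p; under eq_fun do rewrite mxE /=.
- by apply: (@continuous_comp _ _ _ fst fst); [exact: cvg_fst|exact: cvg_fst].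
- by apply: (@continuous_comp _ _ _ fst snd); [exact: cvg_fst|exact: cvg_snd].
- exact: cvg_snd.
Qed.

(** The measurable structure on [R * R * R] is the product one, so the variables are added one at a
    time by two uses of [measurable_fun_caratheodory]. *)
Lemma measurable_fun_pt3 (f : 'cV[R]_3 -> R) : continuous f ->
  measurable_fun setT (fun p => f (pt3 p)).
Proof.
move=> cf.
have cfp (h : R -> R * R * R) : (forall i, continuous (fun s => pt3 (h s) i 0)) ->
    continuous (fun s => f (pt3 (h s))).
  move=> /cv_continuous ch s.
  by apply: (@continuous_comp _ _ _ (fun s => pt3 (h s)) f); [exact: ch|exact: cf].
have cid : continuous (fun s : R => s) by move=> s; exact: cvg_id.
have ccst (a : R) : continuous (fun _ : R => a) by exact: cst_continuous.
apply: measurable_fun_caratheodory => [z|[x y]].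
  apply: measurable_fun_caratheodory => [y|x].
    apply: continuous_measurable_fun; apply: (cfp (fun x => (x, y, z))).
    by case=> [[|[|[|//]]] i3] t; under eq_fun do rewrite mxE /=; first [exact: cid|exact: ccst].
  apply: (cfp (fun y => (x, y, z))).
  by case=> [[|[|[|//]]] i3] t; under eq_fun do rewrite mxE /=; first [exact: cid|exact: ccst].
apply: (cfp (fun z => (x, y, z))).
by case=> [[|[|[|//]]] i3] t; under eq_fun do rewrite mxE /=; first [exact: cid|exact: ccst].
Qed.
End R3.

Lemma col_mx_shift {R : realType} {n : nat} (x : 'cV[R]_3) (th : 'cV[R]_n) (t : R)
    (j : 'I_n) :
  col_mx x (th + t *: delta_mx j 0) = col_mx x th + t *: delta_mx (rshift 3 j) 0.
Proof.
apply/colP => i; case: (split_ordP i) => k ->.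
  by rewrite !mxE (unsplitK (inl k)) eq_lrshift /= mulr0 addr0.
by rewrite !mxE (unsplitK (inr k)) !mxE eq_rshift.
Qed.

(** * Parameter integrals over the robot region with a bounded measurable weight *)

Section WeightedIntegral.
Context {R : realType} {n : nat}.
Variables (Rg : set 'cV[R]_3) (wt : 'cV[R]_3 -> R) (b W : R).

Let D : set (R * R * R) := pt3 @^-1` Rg.

Hypothesis mD : measurable D.
Hypothesis Rg_bounded : forall x, Rg x -> norm2sq x <= b.
Hypothesis mwt : measurable_fun D (fun p => wt (pt3 p)).
Hypothesis W_ge0 : 0 <= W.
Hypothesis wt_le : forall x, Rg x -> `|wt x| <= W.

(** [Rg] is bounded but not assumed closed; this compact set around it carries the compactness
    arguments. *)
Definition cube (B : R) : set 'cV[R]_3 :=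
  pt3 @` (([set` `[- B, B]] `*` [set` `[- B, B]]) `*` [set` `[- B, B]]).

Lemma compact_cube B : compact (cube B).
Proof.
apply: continuous_compact; first exact/continuous_subspaceT/pt3_continuous.
by do 2?apply: compact_setX; exact: segment_compact.
Qed.

Lemma pt3_in_cube p : D p ->
  (([set` `[- (1 + b), 1 + b]] `*` [set` `[- (1 + b), 1 + b]])
     `*` [set` `[- (1 + b), 1 + b]]) p.
Proof.
move=> Dp; have nb := le_trans (norm2sq_ge_sup _) (Rg_bounded Dp).
(* The half-side [1 + b] avoids a square root, since [t <= 1 + t ^+ 2]. *)
have nle : `|pt3 p| <= 1 + b.
  apply: le_trans (_ : 1 + `|pt3 p| ^+ 2 <= _); last by rewrite lerD2l.
  by rewrite expr2; have := sqr_ge0 (`|pt3 p| - 1); rewrite expr2; have := normr_ge0 (pt3 p); nra.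
have c i := le_trans (cvnorm_coord (pt3 p) i) nle.
have := c 0; have := c 1; have := c (lift 0 1); rewrite !mxE /= => c2 c1 c0.
by rewrite /= !in_itv /= -!ler_norml; split; [split|].
Qed.

Lemma Rg_sub_cube : Rg `<=` cube (1 + b).
Proof.
move=> x Rx; pose p : R * R * R := (x 0 0, x 1 0, x (lift 0 1) 0).
have px : pt3 p = x.
  apply/colP => -[[|[|[|//]]] i3]; rewrite mxE /=; congr (x _ _); exact: val_inj.
by exists p => //; apply: pt3_in_cube; rewrite /D /= px.
Qed.

Lemma L3_finite : (L3 D < +oo)%E.
Proof.
apply: (@le_lt_trans _ _ (L3 (([set` `[- (1 + b), 1 + b]] `*` [set` `[- (1 + b), 1 + b]])
     `*` [set` `[- (1 + b), 1 + b]]))).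
  apply: le_measure; rewrite ?inE //; last exact: pt3_in_cube.
  by do 2?apply: measurableX; exact: measurable_itv.
set I := [set` `[- (1 + b), 1 + b]].
have mI : measurable I by exact: measurable_itv.
have [l lE] : exists l : R, lebesgue_measure I = l%:E.
  rewrite lebesgue_measure_itv /=; case: ifP => _; last by exists 0.
  by rewrite -EFinB; eexists.
have E2 : (@lebesgue_measure R \x @lebesgue_measure R)%E (I `*` I) = (l * l)%:E.
  transitivity (lebesgue_measure I * lebesgue_measure I)%E.
    exact: product_measure1E.
  by rewrite EFinM; congr (_ * _)%E; exact: lE.
have E3 : L3 ((I `*` I) `*` I) = (l * l * l)%:E.
  transitivity ((@lebesgue_measure R \x @lebesgue_measure R)%E (I `*` I)
    * lebesgue_measure I)%E.
    by apply: product_measure1E => //; exact: measurableX.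
  by rewrite EFinM; congr (_ * _)%E; [exact: E2|exact: lE].
by rewrite E3 ltry.
Qed.

Lemma wt_integrable (h : 'cV[R]_3 -> R) : continuous h ->
  L3.-integrable D (EFin \o (fun p => wt (pt3 p) * h (pt3 p))).
Proof.
move=> ch; apply: measurable_bounded_integrable => //.
- exact: L3_finite.
- by apply: measurable_funM => //; apply: measurable_funTS; exact: measurable_fun_pt3.
have ck : compact (h @` cube (1 + b)).
  by apply: continuous_compact; [exact: continuous_subspaceT|exact: compact_cube].
have [M [Mr hM]] := compact_bounded ck.
exists (W * (`|M| + 1)); split; first by rewrite num_real.
move=> t lt_t p Dp /=; apply: le_trans (ltW lt_t).
rewrite normrM; apply: ler_pM => //; first exact: wt_le.
apply: hM; first by rewrite (le_lt_trans (ler_norm _)) // ltrDl.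
by exists (pt3 p) => //; exact: Rg_sub_cube.
Qed.

Definition wint (h : 'cV[R]_3 -> R) : R := intR Rg (fun x => wt x * h x).

(** An upper bound for the integral of [|wt|] over the region. *)
Definition wmass : R := W * fine (L3 D).

Lemma wmass_ge0 : 0 <= wmass.
Proof. by rewrite mulr_ge0 // fine_ge0. Qed.

Lemma wint_le (h : 'cV[R]_3 -> R) e : continuous h -> 0 <= e ->
  (forall x, Rg x -> `|h x| <= e) -> `|wint h| <= e * wmass.
Proof.
move=> ch e0 he; have ih := wt_integrable ch.
apply: (@le_trans _ _ (\int[L3]_(p in D) `|wt (pt3 p) * h (pt3 p)|)).
  by apply: le_normr_Rintegral => //; exact: mD.
have -> : e * wmass = \int[L3]_(p in D) (W * e).
  by rewrite Rintegral_cst // /wmass; ring.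
apply: le_Rintegral => //.
- exact: (integrable_norm ih).
- apply: measurable_bounded_integrable => //; first exact: L3_finite.
  exists (W * e); split; first by rewrite num_real.
  by move=> t lt_t p Dp /=; rewrite ger0_norm ?mulr_ge0 // ltW.
- by move=> p Dp; rewrite normrM ler_pM //; [exact: wt_le|exact: he].
Qed.

Lemma wintB (g h : 'cV[R]_3 -> R) : continuous g -> continuous h ->
  wint (fun x => g x - h x) = wint g - wint h.
Proof.
move=> cg ch; rewrite /wint /intR -RintegralB //; try exact: wt_integrable.
by apply: eq_Rintegral => p _; rewrite mulrBr.
Qed.

Lemma wintZ (a : R) (g : 'cV[R]_3 -> R) : continuous g ->
  wint (fun x => a * g x) = a * wint g.
Proof.
move=> cg; rewrite /wint /intR -RintegralZl //; try exact: wt_integrable.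
by apply: eq_Rintegral => p _; rewrite mulrCA.
Qed.

Lemma continuous_col_mx : continuous (fun y : 'cV[R]_3 * 'cV[R]_n => col_mx y.1 y.2).
Proof.
apply: cv_continuous => i.
case: (split_ordP i) => k -> y; under eq_fun do rewrite ?col_mxEu ?col_mxEd.
  apply: (@continuous_comp _ _ _ fst (fun u : 'cV[R]_3 => u k 0)).
    exact: cvg_fst.
  exact: coord_continuous.
apply: (@continuous_comp _ _ _ snd (fun u : 'cV[R]_n => u k 0)).
  exact: cvg_snd.
exact: coord_continuous.
Qed.

Lemma continuous_col_mxl (f : 'cV[R]_(3 + n) -> R) th : continuous f ->
  continuous (fun x => f (col_mx x th)).
Proof.
move=> cf x; apply: (@continuous_comp _ _ _ (fun x => col_mx x th) f); last exact: cf.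
move: x; apply: cv_continuous => i.
case: (split_ordP i) => k -> y; under eq_fun do rewrite ?col_mxEu ?col_mxEd.
  exact: coord_continuous.
exact: cst_continuous.
Qed.

(** A tube lemma: near coverings of the compact cube make the neighbourhood of [th] independent of
    [x]. *)
Lemma tube_near (f : 'cV[R]_(3 + n) -> R) (th : 'cV[R]_n) e : continuous f -> 0 < e ->
  \forall th' \near th, forall x, Rg x -> `|f (col_mx x th') - f (col_mx x th)| <= e.
Proof.
move=> cf e0.
have cF : continuous (fun y : 'cV[R]_3 * 'cV[R]_n => f (col_mx y.1 y.2)).
  move=> y; apply: (@continuous_comp _ _ _ (fun y => col_mx y.1 y.2) f); last exact: cf.
  exact: continuous_col_mx.
(* Both [(x', th')] and [(x', th)] are compared with [(x, th)], at cost [e / 2] each. *)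
have near_x (x : 'cV[R]_3) : \forall x' \near x & th' \near th,
    `|f (col_mx x' th') - f (col_mx x' th)| <= e.
  have e2 : 0 < e / 2 by rewrite divr_gt0.
  have n0 : nbhs (f (col_mx x th)) (fun s => `|f (col_mx x th) - s| < e / 2).
    exact: (nbhsx_ballx (f (col_mx x th)) (e / 2) e2).
  have n1 := cF (x, th) _ n0.
  have n2 := continuous_col_mxl (th := th) cf n0.
  case: n1 => -[A B] /= [nA nB] AB.
  exists (A `&` (fun x' => `|f (col_mx x th) - f (col_mx x' th)| < e / 2), B).
    by split=> //=; exact: filterI.
  move=> [x' th'] /= [[Ax' h2] Bth']; have := AB (x', th') (conj Ax' Bth'); move: h2.
  by rewrite /= !ltr_norml ler_norml => /andP[? ?] /andP[? ?]; apply/andP; split; lra.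
have /compact_near_coveringP cov := @compact_cube (1 + b).
have H := cov _ (nbhs th) (fun th' x => `|f (col_mx x th') - f (col_mx x th)| <= e)
  (nbhs_filter th) (fun x _ => near_x x).
apply: (@filterS _ _ (nbhs_filter th) _ _ _ H) => th' H' x Rx.
by apply: H'; exact: Rg_sub_cube.
Qed.

Variable f : 'cV[R]_(3 + n) -> R.
Hypothesis C1f : C1on (fun j => 3 <= j)%N f.

Let P3 (j : 'I_n) : (3 <= rshift 3 j)%N. Proof. exact: leq_addr. Qed.

Definition wint_param (th : 'cV[R]_n) : R := wint (fun x => f (col_mx x th)).

Lemma continuous_wint_param (g : 'cV[R]_(3 + n) -> R) : continuous g ->
  continuous (fun th => wint (fun x => g (col_mx x th))).
Proof.
move=> cg; pose F th := wint (fun x => g (col_mx x th)).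
suff H (th : 'cV[R]_n) : F th' @[th' --> th] --> F th by exact: H.
have nF := nbhs_filter th.
apply/cvgrPdist_le => e e0.
(* The 1 guards against a vanishing [wmass]. *)
have m1 : 0 < 1 + wmass by rewrite ltr_pwDl ?wmass_ge0.
have e1 : 0 < e / (1 + wmass) by rewrite divr_gt0.
apply: filterS (tube_near th cg e1) => th' H.
rewrite distrC /F -wintB; try exact: continuous_col_mxl.
apply: (@le_trans _ _ (e / (1 + wmass) * wmass)).
  apply: wint_le; [|exact: ltW|exact: H].
  apply: continuous_addf; last apply: continuous_oppf; exact: continuous_col_mxl.
by rewrite -mulrA ler_piMr ?(ltW e0) // mulrC ler_pdivrMr // mul1r lerDr.
Qed.

(** Differentiation under the integral sign. After multiplication by [h], the error of the
    difference quotient is the integral of the increment error of [f]; [tube_near] and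
    [coord_increment] bound that error by [|h|] times a small constant for all [x] at once. *)
Lemma is_partial_wint_param j th : is_partial wint_param j th
  (wint (fun x => partial f (rshift 3 j) (col_mx x th))).
Proof.
set dF := wint _; rewrite /is_partial.
set g := fun t : R => wint_param (th + t *: delta_mx j 0).
have cpf := (C1f.2 _ (P3 j)).2.
suff H : (h^-1 *: ((g \o shift 0) (h *: 1) - g 0)) @[h --> 0^'] --> dF.
  by split; [exact: cvgP H|exact: cvg_lim H].
apply/cvgrPdist_le => e e0.
have m1 : 0 < 1 + wmass by rewrite ltr_pwDl ?wmass_ge0.
have e1 : 0 < e / (1 + wmass) by rewrite divr_gt0.
have /nbhs_ballP [d /= d0 hd] := tube_near th cpf e1.
near=> h.
have h0 : h != 0 by near: h; exact: nbhs_dnbhs_neq.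
have hlt : `|h| < d by near: h; apply: dnbhs0_lt.
rewrite /= scaler1 addr0 /g scale0r addr0 distrC.
set u := wint_param _ - _.
rewrite (_ : h^-1 *: u - dF = h^-1 * (u - h * dF)); last first.
  by rewrite mulrBr mulKf.
rewrite normrM normfV ler_pdivrMl ?normr_gt0 //.
have cth t := continuous_col_mxl (th := t) C1f.1.
have cdf := continuous_col_mxl (th := th) cpf.
rewrite /u /wint_param -wintB // -wintZ // -wintB; last 2 first.
- by apply: continuous_addf => //; apply: continuous_oppf.
- by apply: continuous_mulf => //; exact: cst_continuous.
apply: (@le_trans _ _ (`|h| * (e / (1 + wmass)) * wmass)); last first.
  rewrite -!mulrA ler_wpM2l // ler_piMr ?(ltW e0) //.
  by rewrite mulrC ler_pdivrMr // mul1r lerDr.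
apply: wint_le; [|by rewrite mulr_ge0 // ltW|].
  apply: continuous_addf; last apply: continuous_oppf.
    by apply: continuous_addf => //; apply: continuous_oppf.
  by apply: continuous_mulf => //; exact: cst_continuous.
move=> x Rx; rewrite [h * _]mulrC [leRHS]mulrC col_mx_shift.
apply: (coord_increment C1f (P3 j)) => t th_le.
rewrite -col_mx_shift; apply: hd => //.
rewrite -ball_normE /= opprD addrA subrr sub0r normrN.
apply: le_lt_trans hlt; apply/cvnorm_leP => // i; rewrite !mxE eqxx andbT.
have tle : `|t| <= `|h|.
  case: th_le => /andP[t0 t1]; first by rewrite !ger0_norm // (le_trans t0).
  by rewrite !ler0_norm ?lerN2 // (le_trans t0).
by rewrite normrM (le_trans _ tle) // ler_piMr //; case: (i == j); rewrite ?normr1 ?normr0.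
Unshelve. all: by end_near. Qed.

Lemma C1on_wint_param : C1on predT wint_param.
Proof.
apply: (C1onI (df := fun j th => wint (fun x => partial f (rshift 3 j) (col_mx x th)))).
- exact: continuous_wint_param C1f.1.
- by move=> j th _; exact: is_partial_wint_param.
- by move=> j _; exact: continuous_wint_param (C1f.2 _ (P3 j)).2.
Qed.

Lemma partial_wint_param j th :
  partial wint_param j th = wint (fun x => partial f (rshift 3 j) (col_mx x th)).
Proof. by have [_ ->] := is_partialE (is_partial_wint_param j th). Qed.

End WeightedIntegral.

(** * Fixing one of the two arguments of a joint function *)

Section Slices.
Context {R : realType} {n : nat}.
Implicit Types (f : 'cV[R]_(3 + n) -> R) (x : 'cV[R]_3) (th : 'cV[R]_n).

Lemma partial_slice f x th (j : 'I_n) :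
  partial (fun y => f (col_mx x y)) j th = partial f (rshift 3 j) (col_mx x th).
Proof. by rewrite /partial; under eq_fun do rewrite col_mx_shift. Qed.

Lemma C1on_slice f x : C1on (fun j => 3 <= j)%N f ->
  C1on predT (fun th => f (col_mx x th)).
Proof.
move=> [cf df].
have cs (g : 'cV[R]_(3 + n) -> R) : continuous g -> continuous (fun th : 'cV[R]_n => g (col_mx x th)).
  move=> cg th; apply: (@continuous_comp _ _ _ (fun th => col_mx x th) g); last exact: cg.
  move: th; apply: cv_continuous => i.
  case: (split_ordP i) => k -> y; under eq_fun do rewrite ?col_mxEu ?col_mxEd.
    exact: cst_continuous.
  exact: coord_continuous.
split=> [|j _]; first exact: cs.
have [ef cpf] := df (rshift 3 j) (leq_addr _ _); split=> [th|].
  rewrite /partial_exists; under eq_fun do rewrite col_mx_shift.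
  exact: ef.
rewrite (_ : partial _ j = fun th => partial f (rshift 3 j) (col_mx x th)).
  exact: cs.
by apply/funext => th; rewrite partial_slice.
Qed.

(** Meant for terms such as [X x thm], which see the joint variable through [x] only. *)
Lemma is_partial_freeze f th0 z (j : 'I_(3 + n)) : (3 <= j)%N ->
  is_partial (fun z : 'cV[R]_(3 + n) => f (col_mx (usubmx z) th0)) j z 0.
Proof.
move=> j3; rewrite /is_partial.
rewrite (_ : (fun t : R => _) = fun=> f (col_mx (usubmx z) th0)); first exact: is_derive_cst.
apply/funext => t; congr (f (col_mx _ _)).
apply/colP => i; rewrite !mxE.
have -> : (lshift n i == j) = false 
  by apply/negbTE; rewrite -val_eqE /= neq_ltn (leq_trans (ltn_ord i) j3).
by rewrite mulr0 addr0.
Qed.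

Lemma C1on_freeze f th0 : continuous f ->
  C1on (fun j => 3 <= j)%N (fun z : 'cV[R]_(3 + n) => f (col_mx (usubmx z) th0)).
Proof.
move=> cf; apply: (C1onI (df := fun _ _ => 0)) => [|j z|j _].
- move=> z; apply: (@continuous_comp _ _ _ (fun z : 'cV[R]_(3 + n) => col_mx (usubmx z) th0) f); last exact: cf.
  move: z; apply: cv_continuous => i.
  case: (split_ordP i) => k -> y; under eq_fun do rewrite ?col_mxEu ?col_mxEd ?mxE.
    exact: coord_continuous.
  exact: cst_continuous.
- exact: is_partial_freeze.
- exact: cst_continuous.
Qed.

End Slices.

(** * Common radii and bounds for finite families of continuous functions *)

Section Neighbourhoods.
Context {R : realType} {n : nat} {S : finType}.
Variables (f : S -> 'cV[R]_n -> R) (c : 'cV[R]_n).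
Hypothesis cf : forall s, continuous (f s).

Lemma osc_near (e : R) : 0 < e ->
  exists2 r : R, 0 < r & forall z, `|z - c| <= r -> forall s, `|f s z - f s c| <= e.
Proof.
move=> e0; have nF := nbhs_filter c.
have : \forall z \near c, forall s, `|f s z - f s c| <= e.
  apply: (@filter_forall _ _ _ _ nF) => s; have H := (@cvgrPdist_le _ _ _ _ nF _ _).1 (@cf s c) e e0.
  by apply: (@filterS _ _ nF _ _ _ H) => z; rewrite distrC.
move=> /nbhs_ballP [d /= d0 hd]; exists (d / 2); first by rewrite divr_gt0.
move=> z zd; apply: hd; rewrite -ball_normE /= distrC; apply: le_lt_trans zd _.
by rewrite ltr_pdivrMr // ltr_pMr // ltr1n.
Qed.

Lemma bounded_near :
  exists T : R, 0 < T /\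
  exists2 r : R, 0 < r & forall z, `|z - c| <= r -> forall s, `|f s z| <= T.
Proof.
(* The 1 covers the oscillation on the ball, the sum dominates each value at the center. *)
exists (1 + \sum_s `|f s c|); split; first by rewrite ltr_pwDl // sumr_ge0.
have [r r0 hr] := osc_near (@ltr01 R); exists r => // z zr s.
have -> : f s z = (f s z - f s c) + f s c by rewrite subrK.
apply: (le_trans (ler_normD _ _)); apply: lerD; first exact: hr.
by rewrite (bigD1 s) //= lerDl sumr_ge0.
Qed.

End Neighbourhoods.

(** A feasible block is a nonnegative vector of total mass at most 1, so it contributes at most [T]
    whatever its length. This is where bounds uniform in the weights come from. *)
Lemma feasible_sum_le {R : realType} {c : nat} {V : 'I_c -> nat} (w : Wt V)
    (t : forall i, 'I_(V i) -> R) (T : R) :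
  0 <= T -> feasible w -> (forall i k, `|t i k| <= T) ->
  `|\sum_i \sum_k w i k 0 * t i k| <= c%:R * T.
Proof.
move=> T0 fw tT; apply: (le_trans (ler_norm_sum _ _ _)).
rewrite mulr_natl -[X in _ *+ X]card_ord -sumr_const; apply: ler_sum => i _.
have [w0 w1] := fw i.
apply: (le_trans (ler_norm_sum _ _ _)); apply: (@le_trans _ _ (\sum_k w i k 0 * T)).
  by apply: ler_sum => k _; rewrite normrM ger0_norm // ler_wpM2l.
by rewrite -mulr_suml ler_piMl.
Qed.

(** Homogeneity extends the bound from unit vectors to all vectors. The sup norm is at most the
    Euclidean one, which is at most [sqrt n] times the sup norm; [sqrt n] is rounded up to [n]. *)
Lemma sigma_min_lower {R : realType} {n : nat} (M : 'M[R]_n) (s : R) (u : 'cV[R]_n) :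
  0 < s -> s <= sigma_min M -> `|u| <= n%:R / s * `|M *m u|.
Proof.
move=> s0 sM.
have norm2sq_ge0 m (y : 'cV[R]_m) : 0 <= norm2sq y.
  by apply: sumr_ge0 => i _; rewrite sqr_ge0.
have norm2sqZ (a : R) (y : 'cV[R]_n) : norm2sq (a *: y) = a ^+ 2 * norm2sq y.
  by rewrite /norm2sq mulr_sumr; apply: eq_bigr => i _; rewrite mxE exprMn.
have unit_lower (y : 'cV[R]_n) : norm2sq y = 1 -> s ^+ 2 <= norm2sq (M *m y).
  move=> y1; have : s <= Num.sqrt (norm2sq (M *m y)).
    apply: (le_trans sM); apply: ge_inf; last by exists y.
    by exists 0 => _ [z _ <-]; exact: sqrtr_ge0.
  move=> h; rewrite -[leRHS]sqr_sqrtr // lerXn2r ?nnegrE ?sqrtr_ge0 //.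
  exact: ltW.
have lower : s ^+ 2 * norm2sq u <= norm2sq (M *m u).
  have [u0|u0] := eqVneq (norm2sq u) 0; first by rewrite u0 mulr0.
  have up : 0 < norm2sq u by rewrite lt_def u0 norm2sq_ge0.
  pose a := Num.sqrt (norm2sq u).
  have a2 : a ^+ 2 = norm2sq u by rewrite sqr_sqrtr.
  have := unit_lower (a^-1 *: u); rewrite norm2sqZ -scalemxAr norm2sqZ exprVn a2 mulVf //.
  by move=> /(_ erefl); rewrite ler_pdivlMl // mulrC.
have sq : (s * `|u|) ^+ 2 <= (n%:R * `|M *m u|) ^+ 2.
  have le_sqr (k : nat) : (k <= k ^ 2)%N.
    by case: k => // k; rewrite expnS leq_pmulr // expn_gt0.
  have h1 : s ^+ 2 * `|u| ^+ 2 <= s ^+ 2 * norm2sq u.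
    by rewrite ler_wpM2l ?sqr_ge0 ?norm2sq_ge_sup.
  rewrite exprMn; apply: (le_trans h1); apply: (le_trans lower).
  apply: (le_trans (norm2sq_le_sup _)).
  by rewrite exprMn ler_wpM2r ?sqr_ge0 // -natrX ler_nat.
rewrite mulrAC ler_pdivlMr // [leLHS]mulrC.
by move: sq; rewrite ler_pXn2r ?nnegrE ?mulr_ge0 // ltW.
Qed.

(** * Estimates for [Gmap] near [thm], uniform in [alpha] and in feasible weights *)

Section GmapEstimates.
Context {R : realType} {n : nat}.
Variables (X : 'cV[R]_3 -> 'cV[R]_n -> 'cV[R]_3) (Rg : set 'cV[R]_3)
  (rho : 'cV[R]_3 -> R) (c : nat) (xc : 'I_c -> 'cV[R]_3) (V : 'I_c -> nat)
  (v : forall i : 'I_c, 'cV[R]_n -> 'M[R]_(3, V i))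
  (dt : R) (thm thmm tau : 'cV[R]_n) (sigX : R).

Hypothesis mD : measurable (pt3 @^-1` Rg).
Hypothesis Rg_bounded : exists b : R, forall x, Rg x -> norm2sq x <= b.
Hypothesis mrho : measurable_fun (pt3 @^-1` Rg) (fun p => rho (pt3 p)).
Hypothesis rho_gt0 : forall x, Rg x -> 0 < rho x.
Hypothesis rho_bounded : exists b : R, forall x, Rg x -> rho x <= b.
Hypothesis dt_gt0 : 0 < dt.
Hypothesis smoothX : smooth_mx (fun z : 'cV[R]_(3 + n) => X (usubmx z) (dsubmx z)).
Hypothesis sigX_gt0 : 0 < sigX.
Hypothesis sigX_le : sigX <= sigma_min (Mass X Rg rho dt thm).
Hypothesis C3v : forall i : 'I_c, Ck_mx 3 (v i).

Let P3 (j : 'I_n) : (3 <= rshift 3 j)%N. Proof. exact: leq_addr. Qed.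

Definition Xj (k : 'I_3) (z : 'cV[R]_(3 + n)) : R := X (usubmx z) (dsubmx z) k 0.
Definition wt (x : 'cV[R]_3) : R := rho x / dt ^+ 2.

Lemma XjE x th k : X x th k 0 = Xj k (col_mx x th).
Proof. by rewrite /Xj col_mxKu col_mxKd. Qed.

Lemma dXdthE x th k j : dXdth X x th k j = partial (Xj k) (rshift 3 j) (col_mx x th).
Proof.
rewrite /dXdth mxE -partial_slice; congr (partial _ j th).
by apply/funext => y; exact: XjE.
Qed.

Lemma dXdth_trE x th j k :
  (dXdth X x th)^T j k = partial (Xj k) (rshift 3 j) (col_mx x th).
Proof. by rewrite -dXdthE [LHS]mxE. Qed.

Lemma C1on_Xj P k : C1on P (Xj k).
Proof. by apply: (@Ck_C1on _ _ 0); exact: smoothX. Qed.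

Lemma C1on_dXj P k j : C1on P (partial (Xj k) j).
Proof. by apply: (@Ck_partial_C1on _ _ 0); exact: smoothX. Qed.

(** Common form of the integrals in [Amap] ([th0 = th]) and in [Bmap] ([th0 = thmm]). *)
Lemma wint_paramE (th0 : 'cV[R]_n) (f : 'I_n -> 'cV[R]_(3 + n) -> R) th i :
  (forall x, f i (col_mx x th) = ((dXdth X x th)^T *m (X x th0 - X x thm)) i 0) ->
  intmx Rg (fun x => wt x *: ((dXdth X x th)^T *m (X x th0 - X x thm))) i 0 =
  wint_param Rg wt (f i) th.
Proof.
move=> fE; rewrite mxE /wint_param /wint; congr (intR _ _).
by apply/funext => x; rewrite mxE -fE.
Qed.

(* [fA] and [fB] are the entries of the integrands of [Amap] and of the integral
   in [Bmap], as functions of the joint variable [z = col_mx x th]. *)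
Definition fA i z := \sum_k partial (Xj k) (rshift 3 i) z *
  (Xj k z - Xj k (col_mx (usubmx z) thm)).
Definition fB i z := \sum_k partial (Xj k) (rshift 3 i) z *
  (Xj k (col_mx (usubmx z) thmm) - Xj k (col_mx (usubmx z) thm)).

Lemma AmapE th i : Amap X Rg rho dt thm th i 0 = wint_param Rg wt (fA i) th.
Proof.
apply: (wint_paramE (f := fA)) => x; rewrite mxE; apply: eq_bigr => k _.
by rewrite dXdth_trE !mxE !XjE col_mxKu.
Qed.

Definition B0map th : 'cV[R]_n :=
  intmx Rg (fun x => wt x *: ((dXdth X x th)^T *m (X x thmm - X x thm))).

Lemma B0mapE th i : B0map th i 0 = wint_param Rg wt (fB i) th.
Proof.
apply: (wint_paramE (f := fB)) => x; rewrite mxE; apply: eq_bigr => k _.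
by rewrite dXdth_trE !mxE !XjE col_mxKu.
Qed.

Lemma C1on_fA i : C1on (fun j => 3 <= j)%N (fA i).
Proof.
apply: C1on_sum => k; apply: C1onM; first exact: C1on_dXj.
rewrite (_ : (fun y => _) = fun y => Xj k y + -1 * Xj k (col_mx (usubmx y) thm)).
  apply: C1onD; first exact: C1on_Xj.
  apply: C1onM; first exact: C1on_cst.
  by apply: C1on_freeze; exact: (C1on_Xj predT k).1.
by apply/funext => y; rewrite mulN1r.
Qed.

Lemma C1on_fB i : C1on (fun j => 3 <= j)%N (fB i).
Proof.
apply: C1on_sum => k; apply: C1onM; first exact: C1on_dXj.
rewrite (_ : (fun y => _) = fun y => Xj k (col_mx (usubmx y) thmm)
   + -1 * Xj k (col_mx (usubmx y) thm)).
  apply: C1onD; last apply: C1onM; [|exact: C1on_cst|];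
    by apply: C1on_freeze; exact: (C1on_Xj predT k).1.
by apply/funext => y; rewrite mulN1r.
Qed.

(** By the product rule the second derivatives of [X] come multiplied by [X x th - X x thm], which
    vanishes at [thm]; only the Gram matrix remains. *)
Lemma partial_fA i j x : partial (fA i) (rshift 3 j) (col_mx x thm) =
  ((dXdth X x thm)^T *m dXdth X x thm) i j.
Proof.
pose z := col_mx x thm.
have H : is_partial (fA i) (rshift 3 j) z
    (\sum_k (partial (Xj k) (rshift 3 i) z * (partial (Xj k) (rshift 3 j) z + 0)
      + (Xj k z - Xj k (col_mx (usubmx z) thm)) *
        partial (partial (Xj k) (rshift 3 i)) (rshift 3 j) z)).
  apply: is_partial_sum => k; apply: is_partialM.
    exact: (C1on_is_partial _ (C1on_dXj predT k _) isT).
  rewrite (_ : (fun y => _) = fun y => Xj k y + -1 * Xj k (col_mx (usubmx y) thm)).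
    apply: is_partialD; first exact: (C1on_is_partial _ (C1on_Xj predT k) isT).
    rewrite -(mulr0 (-1)); apply: is_partialZ.
    exact: is_partial_freeze.
  by apply/funext => y; rewrite mulN1r.
have [_ ->] := is_partialE H; rewrite mxE; apply: eq_bigr => k _.
by rewrite dXdth_trE dXdthE /z col_mxKu subrr mul0r !addr0.
Qed.

(** The coefficient of one scalar weight in component [a] of the contact term. Pairing contact and
    component into one finite index type lets [bounded_near] treat all coefficients together. *)
Definition bcoef (s : {i : 'I_c & 'I_(V i)}) (a : 'I_n) (th : 'cV[R]_n) : R :=
  \sum_l dXdth X (xc (tag s)) th l a * v (tag s) th l (tagged s).

Lemma C1on_bcoef s a : C1on predT (bcoef s a).
Proof.
apply: C1on_sum => l; apply: C1onM.
  rewrite (_ : (fun y => _) =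
      fun y => partial (Xj l) (rshift 3 a) (col_mx (xc (tag s)) y)).
    by apply: (C1on_slice (f := partial (Xj l) (rshift 3 a))); exact: C1on_dXj.
  by apply/funext => y; rewrite dXdthE.
by apply: (@Ck_C1on _ _ 2); exact: C3v.
Qed.

Lemma contactE th (w : Wt V) a :
  (\sum_i ((dXdth X (xc i) th)^T *m (v i th *m w i))) a 0 =
  \sum_i \sum_k w i k 0 * bcoef (Tagged (fun i => 'I_(V i)) k) a th.
Proof.
rewrite summxE; apply: eq_bigr => i _; rewrite mulmxA mxE; apply: eq_bigr => k _.
rewrite mulrC mxE; congr (_ * _); apply: eq_bigr => l _.
by rewrite dXdth_trE dXdthE.
Qed.

Lemma GmapE alpha th w a : Gmap X Rg rho xc v dt thm thmm tau alpha th w a 0 =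
  alpha^-1 * wint_param Rg wt (fA a) th + (wint_param Rg wt (fB a) th - tau a 0)
  - \sum_i \sum_k w i k 0 * bcoef (Tagged (fun i => 'I_(V i)) k) a th.
Proof.
have hA := AmapE th a; have hB := B0mapE th a; have hS := contactE th w a.
rewrite /Gmap (_ : Bmap X Rg rho xc v dt thm thmm tau th w =
  B0map th - \sum_i ((dXdth X (xc i) th)^T *m (v i th *m w i)) - tau) //.
move: hA hB hS; move: (Amap _ _ _ _ _ _) (B0map th) (\sum_i (_ *m _)) => AA BB S.
by move=> <- <- <-; rewrite !mxE addrAC -!addrA.
Qed.

Lemma wt_bounds : exists b W : R, [/\ forall x, Rg x -> norm2sq x <= b,
  measurable_fun (pt3 @^-1` Rg) (fun p => wt (pt3 p)), 0 <= W &
  forall x, Rg x -> `|wt x| <= W].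
Proof.
have [b hb] := Rg_bounded; have [W hW] := rho_bounded.
have d2 : 0 < dt ^+ 2 by rewrite exprn_gt0.
exists b, (`|W| / dt ^+ 2); split=> //.
- by apply: measurable_funM => //; exact: measurable_cst.
- by rewrite divr_ge0 // ltW.
- move=> x Rx; rewrite /wt normrM normfV (gtr0_norm d2) ler_pM2r ?invr_gt0 //.
  by rewrite gtr0_norm ?rho_gt0 // (le_trans (hW _ Rx)) // ler_norm.
Qed.

Lemma C1on_wint f : C1on (fun j => 3 <= j)%N f -> C1on predT (wint_param (n := n) Rg wt f).
Proof.
move=> Cf; have [b [W [hb mw W0 hW]]] := wt_bounds.
exact: (C1on_wint_param mD hb mw W0 hW Cf).
Qed.

Lemma is_partial_wint f j th : C1on (fun j => 3 <= j)%N f ->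
  is_partial (wint_param (n := n) Rg wt f) j th
    (partial (wint_param (n := n) Rg wt f) j th).
Proof. by move=> /C1on_wint Cf; exact: (C1on_is_partial _ Cf isT). Qed.

Lemma partial_wint_fA i j :
  partial (wint_param Rg wt (fA i)) j thm = Mass X Rg rho dt thm i j.
Proof.
have [b [W [hb mw W0 hW]]] := wt_bounds.
rewrite (partial_wint_param mD hb mw W0 hW (C1on_fA i)) mxE; congr (intR _ _).
by apply/funext => x; rewrite partial_fA [RHS]mxE.
Qed.

(** An entry of the Jacobian of [Bmap], the part free of [alpha^-1]. *)
Definition jacB (w : Wt V) a j th :=
  partial (wint_param Rg wt (fB a)) j th
  - \sum_i \sum_k w i k 0 * partial (bcoef (Tagged (fun i => 'I_(V i)) k) a) j th.

Lemma is_partial_Gmap alpha th w a j :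
  is_partial (fun y => Gmap X Rg rho xc v dt thm thmm tau alpha y w a 0) j th
   (alpha^-1 * partial (wint_param Rg wt (fA a)) j th + jacB w a j th).
Proof.
under eq_fun do rewrite GmapE.
rewrite /jacB addrA; apply: is_partialD.
  apply: is_partialD; first exact/is_partialZ/is_partial_wint/C1on_fA.
  rewrite -[X in is_partial _ _ _ X]addr0; apply: is_partialD; last exact: is_partial_cst.
  exact/is_partial_wint/C1on_fB.
rewrite -mulN1r; under eq_fun do rewrite -mulN1r; apply: is_partialZ.
apply: is_partial_sum => i; apply: is_partial_sum => k; apply: is_partialZ.
exact: (C1on_is_partial _ (C1on_bcoef _ _) isT).
Qed.

Lemma C1on_Gmap alpha w a :
  C1on predT (fun y => Gmap X Rg rho xc v dt thm thmm tau alpha y w a 0).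
Proof.
under eq_fun do rewrite GmapE.
apply: C1onD.
  apply: C1onD; first by apply: C1onM; [exact: C1on_cst|exact/C1on_wint/C1on_fA].
  by apply: C1onD; [exact/C1on_wint/C1on_fB|exact: C1on_cst].
under eq_fun do rewrite -mulN1r; apply: C1onM; first exact: C1on_cst.
apply: C1on_sum => i; apply: C1on_sum => k; apply: C1onM; first exact: C1on_cst.
exact: C1on_bcoef.
Qed.

(** This removes the [alpha^-1] term at [thm], so [Gmap] is bounded there independently of
    [alpha]. *)
Lemma Amap_thm i : wint_param Rg wt (fA i) thm = 0.
Proof.
rewrite -AmapE mxE (_ : (fun x => _) = fun=> 0).
  by rewrite /intR Rintegral_cst // mul0r.
by apply/funext => x; rewrite subrr mulmx0 scaler0 mxE.
Qed.

(** The tolerance [e] on the rescaled Jacobian is split in two: half for the oscillation of the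
    Jacobian of [Amap], through the choice of [r], and half for the Jacobian of [Bmap], through
    [alpha * Q <= e / 2]. *)
Lemma Gmap_estimates : exists kap e r Q : R,
  [/\ 0 <= kap, 0 < e, 0 < r, 0 < Q &
  [/\ forall u : 'cV[R]_n, `|u| <= kap * `|Mass X Rg rho dt thm *m u|,
      8 * n.+1%:R * (kap * (n%:R * e)) <= 1,
      forall alpha w, 0 < alpha -> alpha * Q <= e / 2 -> feasible w ->
        forall z, `|z - thm| <= r -> forall i j,
        `|jac (fun y => Gmap X Rg rho xc v dt thm thmm tau alpha y w) z i j
          - (alpha^-1 *: Mass X Rg rho dt thm) i j| <= alpha^-1 * e,
      forall alpha w, feasible w ->
        `|Gmap X Rg rho xc v dt thm thmm tau alpha thm w| <= Q &
      forall alpha w w' z, feasible w -> feasible w' -> `|z - thm| <= r ->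
        `|Gmap X Rg rho xc v dt thm thmm tau alpha z w
          - Gmap X Rg rho xc v dt thm thmm tau alpha z w'| <= 2 * Q]].
Proof.
pose kap := n%:R / sigX; have kap0 : 0 <= kap by rewrite divr_ge0 // ltW.
(* [e = d^-1] is dictated by the smallness condition of the Newton section; the [+ 1] keeps [d]
   positive when [kap * n%:R] vanishes. *)
pose d := 8 * n.+1%:R * (kap * n%:R + 1).
have d0 : 0 < d by rewrite mulr_gt0 ?mulr_gt0 ?ltr0Sn // ltr_wpDl // mulr_ge0.
pose e := d^-1; have e0 : 0 < e by rewrite invr_gt0.
have e2 : 0 < e / 2 by rewrite divr_gt0.
pose S := {i : 'I_c & 'I_(V i)}.
have cA (s : 'I_n * 'I_n) : continuous (partial (wint_param Rg wt (fA s.1)) s.2).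
  exact: ((C1on_wint (C1on_fA s.1)).2 s.2 isT).2.
have [r0 r0_gt0 hA] := osc_near thm cA e2.
have cB (s : 'I_n * 'I_n) : continuous (partial (wint_param Rg wt (fB s.1)) s.2).
  exact: ((C1on_wint (C1on_fB s.1)).2 s.2 isT).2.
have [T1 [T1_gt0 [r1 r1_gt0 hB]]] := bounded_near thm cB.
have cB0 (a : 'I_n) : continuous (fun y => wint_param Rg wt (fB a) y + - tau a 0).
  by apply: continuous_addf; [exact: (C1on_wint (C1on_fB a)).1|exact: cst_continuous].
have [T2 [T2_gt0 [r2 r2_gt0 hB0]]] := bounded_near thm cB0.
have cb (s : S * 'I_n) : continuous (bcoef s.1 s.2) by exact: (C1on_bcoef _ _).1.
have [T3 [T3_gt0 [r3 r3_gt0 hb]]] := bounded_near thm cb.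
have cdb (s : S * 'I_n * 'I_n) : continuous (partial (bcoef s.1.1 s.1.2) s.2).
  exact: ((C1on_bcoef _ _).2 _ isT).2.
have [T4 [T4_gt0 [r4 r4_gt0 hdb]]] := bounded_near thm cdb.
pose T := T1 + T2 + T3 + T4; have T0 : 0 < T by rewrite /T !addr_gt0.
have c0 : 0 <= c%:R :> R by exact: ler0n.
(* [Q] has to dominate [T1 + c T4] (Jacobian of [Bmap]), [T2 + c T3] (value at [thm]) and [c T3]
   (contact term of one weight vector). *)
pose Q := (1 + c%:R) * T.
pose r := Num.min r0 (Num.min r1 (Num.min r2 (Num.min r3 r4))).
exists kap, e, r, Q; split=> //.
- by rewrite /r !lt_min r0_gt0 r1_gt0 r2_gt0 r3_gt0 r4_gt0.
- by rewrite /Q mulr_gt0 // ltr_pwDl.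
have center s : 0 < s -> `|thm - thm| <= s by move=> /ltW; rewrite subrr normr0.
split=> //.
- by move=> u; apply: sigma_min_lower.
- have -> : 8 * n.+1%:R * (kap * (n%:R * e)) = 8 * n.+1%:R * (kap * n%:R) * e by ring.
  by rewrite /e ler_pdivrMr // mul1r ler_wpM2l ?mulr_ge0 // lerDl.
- move=> alpha w al0 alQ fw z; rewrite !le_min => /and5P[z0 z1 z2 z3 z4] i j.
  rewrite [X in _ - X]mxE mxE (is_partialE (is_partial_Gmap alpha z w i j)).2.
  rewrite -partial_wint_fA addrAC -mulrBr.
  have h0 := hA z z0 (i, j); have h1 := hB z z1 (i, j).
  have h4 := feasible_sum_le (ltW T4_gt0) fw
    (fun i' k => hdb z z4 (Tagged (fun i => 'I_(V i)) k, i, j)).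
  have hJ : `|jacB w i j z| <= T1 + c%:R * T4.
    by apply: (le_trans (ler_normB _ _)); exact: lerD h1 h4.
  have ai : 0 < alpha^-1 by rewrite invr_gt0.
  apply: (le_trans (ler_normD _ _)); rewrite normrM (gtr0_norm ai).
  have hQ : T1 + c%:R * T4 <= alpha^-1 * (e / 2).
    rewrite ler_pdivlMl //; apply: le_trans alQ; rewrite ler_wpM2l ?(ltW al0) //.
    rewrite /Q mulrDl mul1r; apply: lerD; first by rewrite /T; lra.
    by rewrite ler_wpM2l // /T; lra.
  have h0' := ler_wpM2l (ltW ai) h0.
  have h0'' := lerD h0' (le_trans hJ hQ).
  apply: (le_trans h0''); rewrite -mulrDr ler_wpM2l ?(ltW ai) //.
  by rewrite -splitr.
- move=> alpha w fw; apply/cvnorm_leP => [|i]; first by rewrite /Q mulr_ge0 ?(ltW T0) ?addr_ge0.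
  rewrite GmapE Amap_thm mulr0 add0r.
  have h2 := hB0 thm (center _ r2_gt0) i.
  have h3 := feasible_sum_le (ltW T3_gt0) fw
    (fun i' k => hb thm (center _ r3_gt0) (Tagged (fun i => 'I_(V i)) k, i)).
  apply: (le_trans (ler_normB _ _)); apply: (le_trans (lerD h2 h3)).
  rewrite /Q mulrDl mul1r; apply: lerD; first by rewrite /T; lra.
  by rewrite ler_wpM2l // /T; lra.
move=> alpha w w' z fw fw'; rewrite !le_min => /and5P[_ _ _ z3 _].
have Q0 : 0 <= 2 * Q by rewrite /Q !mulr_ge0 ?(ltW T0) ?addr_ge0.
apply/(cvnorm_leP _ Q0) => i; rewrite mxE [X in _ + X]mxE !GmapE.
have h3 := feasible_sum_le (ltW T3_gt0) fw
    (fun i' k => hb z z3 (Tagged (fun i => 'I_(V i)) k, i)).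
have h3' := feasible_sum_le (ltW T3_gt0) fw'
    (fun i' k => hb z z3 (Tagged (fun i => 'I_(V i)) k, i)).
set s := \sum_i _ in h3 *; set s' := \sum_i _ in h3' *; set g := alpha^-1 * _ + (_ - _).
have -> : g - s - (g - s') = s' - s by ring.
apply: (le_trans (ler_normB _ _)); apply: (le_trans (lerD h3' h3)).
have : c%:R * T3 <= Q.
  rewrite /Q mulrDl mul1r -[leLHS]add0r; apply: lerD; first exact: ltW.
  by rewrite ler_wpM2l // /T; lra.
by lra.
Qed.
End GmapEstimates.

(** * Entrywise continuity of matrix-valued maps *)

Section EntrywiseContinuity.
Context {R : realType} {T : topologicalType}.

Definition cmx {p q : nat} (F : T -> 'M[R]_(p, q)) : Prop :=
  forall i j, continuous (fun t => F t i j).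

Lemma cmx_cst {p q : nat} (A : 'M[R]_(p, q)) : cmx (fun=> A).
Proof. by move=> i j; exact: cst_continuous. Qed.

Lemma cmx_tr {p q : nat} (F : T -> 'M[R]_(p, q)) : cmx F -> cmx (fun t => (F t)^T).
Proof. by move=> cF i j; under eq_fun do rewrite mxE; exact: (cF j i). Qed.

Lemma cmx_opp {p q : nat} (F : T -> 'M[R]_(p, q)) : cmx F -> cmx (fun t => - F t).
Proof. by move=> cF i j; under eq_fun do rewrite mxE; exact: (continuous_oppf (cF i j)). Qed.

Lemma cmx_add {p q : nat} (F G : T -> 'M[R]_(p, q)) :
  cmx F -> cmx G -> cmx (fun t => F t + G t).
Proof. by move=> cF cG i j; under eq_fun do rewrite mxE; exact: (continuous_addf (cF i j) (cG i j)). Qed.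

Lemma cmx_sum {I : Type} (s : seq I) {p q : nat} (F : I -> T -> 'M[R]_(p, q)) :
  (forall k, cmx (F k)) -> cmx (fun t => \sum_(k <- s) F k t).
Proof.
move=> cF i j; under eq_fun do rewrite summxE.
by apply: continuous_sumf => k; exact: (cF k i j).
Qed.

Lemma cmx_mul {p q s : nat} (F : T -> 'M[R]_(p, q)) (G : T -> 'M[R]_(q, s)) :
  cmx F -> cmx G -> cmx (fun t => F t *m G t).
Proof.
move=> cF cG i j; under eq_fun do rewrite mxE.
by apply: continuous_sumf => k; exact: (continuous_mulf (cF i k) (cG k j)).
Qed.

End EntrywiseContinuity.

(** * Existence of a minimizer of the subproblem *)

Section Subproblem.
Context {R : realType} {n : nat}.
Variables (X : 'cV[R]_3 -> 'cV[R]_n -> 'cV[R]_3) (Rg : set 'cV[R]_3)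
  (rho : 'cV[R]_3 -> R) (c : nat) (xc : 'I_c -> 'cV[R]_3) (V : 'I_c -> nat)
  (v : forall i : 'I_c, 'cV[R]_n -> 'M[R]_(3, V i))
  (dt : R) (thm thmm tau : 'cV[R]_n) (alpha gam : R) (th : 'cV[R]_n) (w : Wt (R := R) V).

Let S := {i : 'I_c & 'I_(V i)}.
Let N := #|{: S}|.

(** Weights form a dependent family of vectors; flattening them into one row vector over all pairs
    makes compactness in finite dimension available. *)
Let decode (g : 'rV[R]_N) : Wt (R := R) V :=
  fun i => \col_k g 0 (enum_rank (Tagged (fun i => 'I_(V i)) k : S)).

Let encode (u : Wt (R := R) V) : 'rV[R]_N :=
  \row_s u (tag (enum_val s)) (tagged (enum_val s)) 0.

Lemma encodeK u : decode (encode u) = u.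
Proof.
apply: functional_extensionality_dep => i; apply/colP => k.
by rewrite !mxE enum_rankK.
Qed.

Let K : set 'rV[R]_N := [set g | feasible (decode g)].

(** A closed subset of the unit cube: nonnegative entries with block sum at most 1 are each at most
    1. *)
Lemma compact_feasible : compact K.
Proof.
apply: (@subclosed_compact _ _ [set g : 'rV[R]_N | forall s, `[0, 1]%classic (g ord0 s)]).
- have -> : K = (\bigcap_(s in [set: 'I_N]) ((fun g : 'rV[R]_N => g 0 s) @^-1` [set x | 0 <= x]))
     `&` (\bigcap_(i in [set: 'I_c]) ((fun g : 'rV[R]_N => \sum_k decode g i k 0) @^-1`
       [set x | x <= 1])).
    apply/seteqP; split=> [g fg|g [g0 g1] i].
      split=> [s _|i _]; last exact: (fg i).2.
      by have := (fg (tag (enum_val s))).1 (tagged (enum_val s)); rewrite mxE taggedK enum_valK.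
    by split=> [k|]; [rewrite mxE; exact: g0|exact: g1].
  apply: closedI.
    apply: closed_bigI => s _; apply: closed_comp; last exact: closed_ge.
    by move=> g _; exact: coord_continuous.
  apply: closed_bigI => i _; apply: closed_comp; last exact: closed_le.
  suff cs : continuous (fun g : 'rV[R]_N => \sum_k decode g i k 0) by move=> g _; exact: cs.
  apply: continuous_sumf => k; under eq_fun do rewrite mxE.
  exact: coord_continuous.
- have H := @rV_compact R N (fun=> `[0, 1]%classic).
  by apply: H => _; exact: segment_compact.
- move=> g fg s; rewrite /= in_itv /=.
  have [h0 h1] := fg (tag (enum_val s)).
  have := h0 (tagged (enum_val s)); rewrite mxE taggedK enum_valK => g0.
  rewrite g0 /=; apply: le_trans h1.
  rewrite (bigD1 (tagged (enum_val s))) //= mxE taggedK enum_valK lerDl.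
  by apply: sumr_ge0 => k _; exact: h0.
Qed.

Lemma qobj_continuous : continuous (fun g : 'rV[R]_N =>
  qobj X Rg rho xc v dt thm thmm tau alpha gam th w (fun i => decode g i - w i)).
Proof.
pose dw g : Wt (R := R) V := fun i => decode g i - w i.
have cdw i : cmx (fun g => dw g i).
  apply: cmx_add; last exact: cmx_cst.
  move=> k j; under eq_fun do rewrite mxE; exact: coord_continuous.
pose J g := invmx (dGdth X Rg rho xc v dt thm thmm tau alpha th w)
  *m dGdw_apply X xc v th (dw g).
have cJ : cmx J.
  apply: cmx_mul; first exact: cmx_cst.
  apply: cmx_opp; apply: cmx_sum => i; apply: cmx_mul; first exact: cmx_cst.
  by apply: cmx_mul => //; exact: cmx_cst.
apply: continuous_addf; first apply: continuous_addf.
- apply: continuous_oppf.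
  by apply: (cmx_mul (F := fun=> _) (G := J)) => //; exact: cmx_cst.
- apply: continuous_mulf; first exact: cst_continuous.
  apply: (cmx_mul (G := J)) => //; apply: cmx_mul; last exact: cmx_cst.
  exact: cmx_tr.
- apply: continuous_mulf; last exact: cst_continuous.
  apply: continuous_sumf => i; apply: continuous_sumf => k.
  by under eq_fun do rewrite expr2; apply: continuous_mulf; exact: (cdw i k 0).
Qed.

(** The extreme value theorem, with the total weights [w + dw] as the variable, since feasibility
    constrains the total; [w] itself shows that the set is nonempty. *)
Lemma qobj_argmin : feasible w -> exists dw : Wt (R := R) V,
  feasible (Wadd w dw) /\ forall d', feasible (Wadd w d') ->
    qobj X Rg rho xc v dt thm thmm tau alpha gam th w dw <=
    qobj X Rg rho xc v dt thm thmm tau alpha gam th w d'.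
Proof.
move=> fw.
have K0 : K !=set0 by exists (encode w); rewrite /K /= encodeK.
have [g Kg gmin] := compact_EVT_min K0 compact_feasible
  (continuous_subspaceT qobj_continuous).
have addB (u : Wt (R := R) V) : Wadd w (fun i => u i - w i) = u.
  by apply: functional_extensionality_dep => i; rewrite /Wadd addrC subrK.
exists (fun i => decode g i - w i); split; first by rewrite addB; move: Kg; rewrite inE.
move=> d' fd'; have := gmin (encode (Wadd w d')).
rewrite inE /K /= !encodeK => /(_ fd').
rewrite (_ : (fun i => Wadd w d' i - w i) = d') //.
by apply: functional_extensionality_dep => i; rewrite /Wadd addrAC subrr add0r.
Qed.

End Subproblem.

(** * The invariant of a run and the construction of runs *)

Section Run.
Context {R : realType} {n : nat}.
Variables (X : 'cV[R]_3 -> 'cV[R]_n -> 'cV[R]_3) (Rg : set 'cV[R]_3)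
  (rho : 'cV[R]_3 -> R) (c : nat) (xc : 'I_c -> 'cV[R]_3) (V : 'I_c -> nat)
  (v : forall i : 'I_c, 'cV[R]_n -> 'M[R]_(3, V i))
  (dt : R) (thm thmm tau : 'cV[R]_n) (eta eps kap e r Q alpha : R).

Let G (w : Wt (R := R) V) y := Gmap X Rg rho xc v dt thm thmm tau alpha y w.
Let M := alpha^-1 *: Mass X Rg rho dt thm.

Hypothesis kap_ge0 : 0 <= kap.
Hypothesis e_ge0 : 0 <= e.
Hypothesis Q_ge0 : 0 <= Q.
Hypothesis alpha_gt0 : 0 < alpha.
Hypothesis Mass_lower : forall u : 'cV[R]_n, `|u| <= kap * `|Mass X Rg rho dt thm *m u|.
Hypothesis small : 8 * n.+1%:R * (kap * (n%:R * e)) <= 1.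
Hypothesis C1G : forall w a, C1on predT (fun y => G w y a 0).
Hypothesis jacG : forall w, feasible w -> forall z, `|z - thm| <= r ->
  forall i j, `|jac (G w) z i j - M i j| <= alpha^-1 * e.
Hypothesis G_thm : forall w, feasible w -> `|G w thm| <= Q.
Hypothesis G_lip : forall w w' z, feasible w -> feasible w' -> `|z - thm| <= r ->
  `|G w z - G w' z| <= 2 * Q.
(* [2 alpha kap Q] bounds the distance of the zeros of [G] to [thm], and the
   Newton path from such a point has length at most [8 alpha kap Q]. *)
Hypothesis r_large : 10 * (alpha * kap * Q) <= r.

Let akQ_ge0 : 0 <= alpha * kap * Q.
Proof. by rewrite !mulr_ge0 // ltW. Qed.

Let ak_ge0 : 0 <= alpha * kap.
Proof. by rewrite mulr_ge0 // ltW. Qed.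

Let ae_ge0 : 0 <= alpha^-1 * e.
Proof. by rewrite mulr_ge0 // invr_ge0 ltW. Qed.

Let M_lower (u : 'cV[R]_n) : `|u| <= alpha * kap * `|M *m u|.
Proof.
rewrite /M -scalemxAl normrZ gtr0_norm ?invr_gt0 // mulrCA !mulrA mulVf ?gt_eqF //.
by rewrite mul1r.
Qed.

(** The Newton section is applied with [M], [alpha * kap] and [alpha^-1 * e]; [alpha] cancels in the
    product, so the contraction factor is uniform in [alpha]. *)
Let small' : 8 * n.+1%:R * (alpha * kap * (n%:R * (alpha^-1 * e))) <= 1.
Proof.
have -> : alpha * kap * (n%:R * (alpha^-1 * e)) = kap * (n%:R * e).
  by field; rewrite gt_eqF.
exact: small.
Qed.

Let center_box : `|thm - thm| <= r.
Proof. by rewrite subrr normr0; apply: le_trans r_large; rewrite mulr_ge0. Qed.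

(** The hypothesis [start] of the Newton iteration, with [alpha * kap] for [kap]. *)
Definition feasible_start (w : Wt (R := R) V) (th0 : 'cV[R]_n) : Prop :=
  feasible w /\ `|th0 - thm| + 4 * (alpha * kap) * `|G w th0| <= r.

(** [newton] fixes every zero of [G w], whatever [invmx] returns there, so the two cases of
    [proj_run] merge into one recursion. *)
Lemma proj_run_newton w th0 psi out :
  proj_run X Rg rho xc v dt thm thmm tau alpha w th0 psi out <->
  [/\ psi 0 = th0, forall j, psi j.+1 = newton (G w) (psi j),
   forall j, G w (psi j) <> 0 -> jac (G w) (psi j) \in unitmx & psi @ \oo --> out].
Proof.
split=> [[p0 [pz [ps po]]]|[p0 ps pu po]].
  split=> // j; last by move=> /ps[].
  have [z|/ps[_ //]] := pselect (G w (psi j) = 0).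
  by rewrite /newton z mulmx0 subr0 pz.
split=> //; split=> [j z|]; first by rewrite ps /newton -/(G w (psi j)) [G _ _]z mulmx0 subr0.
by split=> // j nz; split; [exact: pu|exact: ps].
Qed.

(** The path length only serves to place the limit in the box. Its distance to [thm] then comes from
    [dist_center], with a bound that does not involve the starting point. *)
Lemma proj_run_facts w th0 psi out : feasible_start w th0 ->
  proj_run X Rg rho xc v dt thm thmm tau alpha w th0 psi out ->
  [/\ G w out = 0, `|out - thm| <= 2 * (alpha * kap * Q) &
      proj_rate X Rg rho xc v dt thm thmm tau alpha w psi].
Proof.
move=> [fw st] /proj_run_newton [p0 ps _ po].
rewrite -p0 in st.
have jG := jacG fw.
have [d Gout] := newton_limit ae_ge0 ak_ge0 M_lower (C1G w) jG small' ps st po.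
have out_box : `|out - thm| <= r.
  have -> : out - thm = (out - psi 0%N) + (psi 0%N - thm) by rewrite addrA subrK.
  apply: (le_trans (ler_normD _ _)); apply: le_trans st.
  by rewrite addrC lerD2l.
split=> //.
  have := dist_center ae_ge0 ak_ge0 M_lower (C1G w) jG small' center_box out_box.
  rewrite Gout normr0 add0r -mulrA => h; apply: (le_trans h).
  by rewrite ler_wpM2l // ler_wpM2l // G_thm.
move=> j _.
exact: (newton_rate ae_ge0 ak_ge0 M_lower (C1G w) jG small' ps st).
Qed.

Lemma proj_run_exists w th0 : feasible_start w th0 -> exists psi out,
  proj_run X Rg rho xc v dt thm thmm tau alpha w th0 psi out.
Proof.
move=> [fw st]; pose psi j := iter j (newton (G w)) th0.
have jG := jacG fw.
have ps j : psi j.+1 = newton (G w) (psi j) by [].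
have [out po] := newton_cvg ae_ge0 ak_ge0 M_lower (C1G w) jG small' ps st.
exists psi, out; apply/proj_run_newton; split=> // j _.
apply: (jac_unit ae_ge0 ak_ge0 M_lower jG small').
exact: (newton_iterates_box ae_ge0 ak_ge0 M_lower (C1G w) jG small' ps st).
Qed.

Definition good (th : 'cV[R]_n) (w : Wt (R := R) V) : Prop :=
  [/\ feasible w, G w th = 0 & `|th - thm| <= 2 * (alpha * kap * Q)].

Lemma good_box th w : good th w -> `|th - thm| <= r.
Proof. move=> [_ _ h]; apply: (le_trans h); by have := akQ_ge0; move: r_large; lra. Qed.

Lemma good_start th w w' : good th w -> feasible w' -> feasible_start w' th.
Proof.
move=> gd fw'; split=> //; have [fw Gz h] := gd.
have := G_lip fw' fw (good_box gd); rewrite Gz subr0 => h2.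
by have := ler_wpM2l ak_ge0 h2; move: r_large h; lra.
Qed.

Lemma feasible_W0 : feasible (@W0 R c V).
Proof.
move=> i; split=> [k|]; first by rewrite /W0 mxE.
by rewrite big1 // => k _; rewrite /W0 mxE.
Qed.

Lemma thm_start : feasible_start (@W0 R c V) thm.
Proof.
split; first exact: feasible_W0.
have := ler_wpM2l ak_ge0 (G_thm feasible_W0); rewrite subrr normr0.
by move: r_large akQ_ge0; lra.
Qed.

Lemma proj_good w th0 psi out : feasible_start w th0 ->
  proj_run X Rg rho xc v dt thm thmm tau alpha w th0 psi out -> good out w.
Proof. by move=> st /(proj_run_facts st) [? ? _]; split=> //; case: st. Qed.

Lemma run_good th w gam dw cand psi stop :
  pgm_run X Rg rho xc v dt thm thmm tau alpha eta eps th w gam dw cand psi stop ->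
  forall k, active stop k -> good (th k) (w k).
Proof.
move=> [w0 [_ [p0 [step _]]]]; elim=> [_|k IHk ak].
  by rewrite w0; exact: proj_good thm_start p0.
have {IHk} gk : good (th k) (w k).
  by apply: IHk; move: ak; case: (stop) => //= T; exact: ltnW.
have [_ [fw [_ [pr [up down]]]]] := step k ak.
have [le|lt] := leP (Kmap X Rg rho dt thm (cand k.+1)) (Kmap X Rg rho dt thm (th k)).
  have [_ [-> ->]] := down le.
  exact: proj_good (good_start gk fw) pr.
by have [_ [-> ->]] := up lt.
Qed.

Lemma run_rate th w gam dw cand psi stop :
  pgm_run X Rg rho xc v dt thm thmm tau alpha eta eps th w gam dw cand psi stop ->
  forall k, active stop k ->
  proj_rate X Rg rho xc v dt thm thmm tau alpha (wproj w dw k) (psi k).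
Proof.
move=> run k; have gd := run_good run; move: run => [_ [_ [p0 [step _]]]].
case: k => [_|k ak]; first by have [] := proj_run_facts thm_start p0.
have gk : good (th k) (w k).
  by apply: gd; move: ak; case: (stop) => //= T; exact: ltnW.
have [_ [fw [_ [pr _]]]] := step k ak.
by have [] := proj_run_facts (good_start gk fw) pr.
Qed.

Let K := Kmap X Rg rho dt thm.

Let State := ('cV[R]_n * Wt (R := R) V * R)%type.
Let Step := (Wt (R := R) V * 'cV[R]_n * (nat -> 'cV[R]_n))%type.

Let is_step (s : State) (d : Step) : Prop :=
  let: (th, w, gam) := s in let: (dw, cand, psi) := d in
  [/\ feasible (Wadd w dw),
   forall d', feasible (Wadd w d') ->
     qobj X Rg rho xc v dt thm thmm tau alpha gam th w dw <=
     qobj X Rg rho xc v dt thm thmm tau alpha gam th w d' &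
   proj_run X Rg rho xc v dt thm thmm tau alpha (Wadd w dw) th psi cand].

(** The implication, with a dummy value off the invariant, makes the relation total, so that
    [choice] gives a function on all states. *)
Lemma step_exists (s : State) : exists d : Step, good s.1.1 s.1.2 -> is_step s d.
Proof.
case: s => -[th w] gam; have [gd|] := pselect (good th w); last first.
  by move=> ngd; exists (@W0 R c V, 0, fun=> 0).
have [fw _ _] := gd.
have [dw [fdw mdw]] := qobj_argmin X Rg rho xc v dt thm thmm tau alpha gam th fw.
have [psi [cand pr]] := proj_run_exists (good_start gd fdw).
by exists (dw, cand, psi).
Qed.

Lemma run_exists : exists th w gam dw cand psi stop,
  pgm_run X Rg rho xc v dt thm thmm tau alpha eta eps th w gam dw cand psi stop.
Proof.
have [psi0 [th0 p0]] := proj_run_exists thm_start.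
have [F hF] := choice step_exists.
pose next (s : State) : State :=
  if K s.1.1 < K (F s).1.2 then (s.1.1, s.1.2, eta * s.2)
  else ((F s).1.2, Wadd s.1.2 (F s).1.1, s.2 / eta).
pose st k : State := iter k next (th0, @W0 R c V, 1).
have gst k : good (st k).1.1 (st k).1.2.
  elim: k => [|k IHk]; first exact: proj_good thm_start p0.
  rewrite /st iterS -/(st k) /next; case: ifP => // _ /=.
  move: (hF _ IHk); case: (st k) IHk => -[th w] gam /= gd.
  case: (F _) => -[dw cand] psi /= [fdw _ pr].
  exact: proj_good (good_start gd fdw) pr.
pose th k := (st k).1.1; pose w k := (st k).1.2; pose gam k := (st k).2.
(* Entry [k.+1] of [dw] and [cand] is computed from state [k]; entry 0 is arbitrary. *)
pose dw k := (F (st k.-1)).1.1; pose cand k := (F (st k.-1)).1.2.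
pose psi k := if k is k'.+1 then (F (st k')).2 else psi0.
pose ret k := returns_at X Rg rho dt thm eps th cand k.
(* The recursion never halts; the stopping time is read off afterwards as the least returning index,
   if there is one. *)
have [stop hstop] : exists stop : option nat,
    if stop is Some T then ret T /\ (forall k, (k < T)%N -> ~ ret k)
    else forall k, ~ ret k.
  have [ex|nex] := pselect (exists k, ret k); last first.
    by exists None => k rk; apply: nex; exists k.
  have exb : exists k, `[< ret k >] by have [k rk] := ex; exists k; apply/asboolP.
  exists (Some (ex_minn exb)); case: ex_minnP => T /asboolP rT minT; split=> // k kT rk.
  by have := minT k; rewrite leqNgt kT => /(_ (introT (asboolP _) rk)).
exists th, w, gam, dw, cand, psi, stop; do 3!split=> //; split=> // k _.
have gk := gst k; have := hF _ gk; rewrite /th /w /gam /dw /cand /psi -[k.+1.-1]/k.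
have -> : st k.+1 = next (st k) by [].
rewrite /next; case: (st k) gk => -[thk wk] gk /= gd.
case: (F _) => -[dwk candk] psik /= [fdw mdw pr].
split.
  apply: (jac_unit ae_ge0 ak_ge0 M_lower (jacG _) small'); last exact: good_box gd.
  by case: gd.
do 3!split=> //; split=> h.
  by rewrite /K h.
by rewrite /K ltNge h.
Qed.

End Run.

(** * Choice of the constants and the three conclusions *)

Unset Implicit Arguments.

Theorem theorem4 (R : realType) (n : nat)
    (X : 'cV[R]_3 -> 'cV[R]_n -> 'cV[R]_3) (Rg : set 'cV[R]_3) (rho : 'cV[R]_3 -> R)
    (c : nat) (xc : 'I_c -> 'cV[R]_3) (V : 'I_c -> nat)
    (v : forall i : 'I_c, 'cV[R]_n -> 'M[R]_(3, V i))
    (dt : R) (thm thmm tau : 'cV[R]_n) (eta eps sigX : R) :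
  (* standing assumptions of the setting *)
  measurable (pt3 @^-1` Rg) ->
  (exists b : R, forall x, Rg x -> norm2sq x <= b) ->
  measurable_fun (pt3 @^-1` Rg) (fun p => rho (pt3 p)) ->
  (forall x, Rg x -> 0 < rho x) ->
  (exists b : R, forall x, Rg x -> rho x <= b) ->
  injective xc -> (forall i, Rg (xc i)) ->
  0 < dt -> 1 < eta -> 0 < eps ->
  (* (A1) *)
  smooth_mx (fun z : 'cV[R]_(3 + n) => X (usubmx z) (dsubmx z)) ->
  (* (A2) *)
  0 < sigX -> sigX <= sigma_min (Mass X Rg rho dt thm) ->
  (* (A3) *)
  (forall i : 'I_c, Ck_mx 3 (v i)) ->
  exists r : R, 0 < r /\
  exists MV : R, 0 < MV /\
  forall beta : R, 0 < beta <= 1 ->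
  exists alpha3 : R, 0 < alpha3 /\
  forall alpha : R, 0 < alpha <= 1 -> alpha <= alpha3 ->
    (exists th w gam dw cand psi stop,
        pgm_run X Rg rho xc v dt thm thmm tau alpha eta eps th w gam dw cand psi stop) /\
    (forall th w gam dw cand psi stop,
        pgm_run X Rg rho xc v dt thm thmm tau alpha eta eps th w gam dw cand psi stop ->
        (forall k, active stop k -> Vmap X Rg rho xc v dt thm thmm tau alpha (th k) (w k) <= MV) /\
        (forall k, active stop k -> Num.sqrt (norm2sq (th k - thm)) <= r * beta / 2) /\
        (forall k, active stop k ->
           proj_rate X Rg rho xc v dt thm thmm tau alpha (wproj w dw k) (psi k))).
Proof.
move=> mD Rgb mrho rho0 rhob _ _ dt0 _ _ smX sig0 sigle C3v.
have [kap [e [r [Q [kap0 e0 r0 Q0 [Ml small jacb Gb Gl]]]]]] := Gmap_estimates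
  xc thmm tau mD Rgb mrho rho0 rhob dt0 smX sig0 sigle C3v.
have kQ : 0 <= kap * Q by rewrite mulr_ge0 // ltW.
(* All iterates are exact zeros of [Gmap], so [Vmap] vanishes on them and any positive bound
   serves. *)
exists r; split=> //; exists 1; split=> // beta /andP[be0 be1].
(* The 10 is the constant of [r_large], [n.+1] converts the sup norm into the Euclidean one, and
   [+ 1] keeps [d] positive. *)
pose d := 10 * n.+1%:R * (kap * Q + 1).
have d0 : 0 < d by rewrite mulr_gt0 ?mulr_gt0 ?ltr0Sn // ltr_wpDl.
have be2 : 0 < r * beta / 2 by rewrite divr_gt0 // mulr_gt0.
(* The first bound gives [alpha * Q <= e / 2] for the Jacobian estimate; the second confines the
   iterates to the ball of radius [r * beta / 2]. *)
exists (Num.min (e / 2 / Q) (r * beta / 2 / d)); split.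
  by rewrite lt_min (divr_gt0 be2 d0) !divr_gt0.
move=> alpha /andP[al0 _]; rewrite le_min (ler_pdivlMr _ _ Q0) (ler_pdivlMr _ _ d0) => /andP[alQ ald].
have akQ : 10 * n.+1%:R * (alpha * kap * Q) <= r * beta / 2.
  apply: le_trans ald; rewrite (_ : alpha * d = 10 * n.+1%:R * (alpha * kap * Q)
    + alpha * (10 * n.+1%:R)); last by rewrite /d; ring.
  by rewrite lerDl !mulr_ge0 // ltW.
have akQ0 : 0 <= alpha * kap * Q by rewrite -mulrA mulr_ge0 // ltW.
have n1 : (1 : R) <= n.+1%:R by rewrite ler1n.
have akQn : alpha * kap * Q <= n.+1%:R * (alpha * kap * Q) by rewrite ler_peMl.
have r_large : 10 * (alpha * kap * Q) <= r.
  apply: (@le_trans _ _ (r * beta / 2)); first by apply: le_trans akQ; lra.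
  rewrite -[leRHS]mulr1 -mulrA; apply: ler_wpM2l; [exact: ltW|lra].
have C1G (w : Wt V) a :
    C1on predT (fun y => Gmap X Rg rho xc v dt thm thmm tau alpha y w a 0).
  exact: C1on_Gmap.
have jG w (fw : feasible w) := jacb alpha w al0 alQ fw.
have e0' := ltW e0; have Q0' := ltW Q0.
split.
  exact: (run_exists eta eps kap0 e0' Q0' al0 Ml small C1G jG (Gb alpha) (Gl alpha) r_large).
move=> th w gam dw cand psi stop run.
have gd := run_good kap0 e0' Q0' al0 Ml small C1G jG (Gb alpha) (Gl alpha) r_large run.
split; [|split].
- move=> k /gd [_ Gz _]; rewrite /Vmap Gz /norm2sq big1 // => i _.
  by rewrite mxE expr0n.
- move=> k /gd [_ _ h].
  rewrite -[leRHS]ger0_norm ?(ltW be2) // -sqrtr_sqr ler_sqrt ?sqr_ge0 //.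
  apply: (le_trans (norm2sq_le_sup _)).
  have sq : n%:R * `|th k - thm| ^+ 2 <= (n.+1%:R * `|th k - thm|) ^+ 2.
    rewrite exprMn ler_wpM2r ?sqr_ge0 // -natrX ler_nat.
    by rewrite expnS (leq_trans (leqnSn n)) // leq_pmulr // expn_gt0.
  apply: (le_trans sq); rewrite lerXn2r ?nnegrE ?(ltW be2) ?mulr_ge0 //.
  apply: le_trans akQ; rewrite -mulrA [leRHS]mulrCA ler_wpM2l //.
  by apply: (le_trans h); lra.
exact: (run_rate kap0 e0' Q0' al0 Ml small C1G jG (Gb alpha) (Gl alpha) r_large run).
Qed.
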